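(* For every $k\in\{1,2,\ldots\}$ there is a polyregular function $f:\Sigma^*\to\Gamma^*$ (for some finite alphabets $\Sigma,\Gamma$) whose growth rate is $\Theta(n^2)$ and which is not computed by any $k$-pebble transducer.
   Context: An MSO interpretation $f:\mathcal C\to\mathcal D$ between classes of finite structures is given by components $q\in Q$ with dimensions $\dim(q)\in\{0,1,\ldots\}$, universe formulas $\varphi_q(x_1,\ldots,x_{\dim(q)})$ and, for each output relation $R$ of arity $\ell$ and components $q_1,\ldots,q_\ell$, a formula $\varphi_{R,q_1,\ldots,q_\ell}$ with $\sum_i\dim(q_i)$ free variables; all are MSO formulas over the input vocabulary with first-order free variables. On input $A$ the output universe is $\coprod_{q}\{\bar a\in A^{\dim(q)}: A\models\varphi_q(\bar a)\}$ and $R$ holds of $((q_1,\bar a_1),\ldots,(q_\ell,\bar a_\ell))$ iff $A\models\varphi_{R,q_1,\ldots,q_\ell}(\bar a_1\cdots\bar a_\ell)$. A string-to-string MSO interpretation has type $\Sigma^*\to\Gamma^*$, strings being represented with universe = positions, order $\le$ and unary label predicates $a(x)$; polyregular functions are exactly the functions defined by such interpretations. Growth rate of $f$: $n\mapsto\max\{|f(w)|:|w|\le n\}$. Pebble transducer: for a string-to-string MSO interpretation, call components states; a configuration on input $w$ is a pair (state $q$, tuple $\bar a$ of positions of $w$ of length $\dim(q)$ satisfying $\varphi_q$), i.e. an output position; the tuple is the pebble stack, its length the stack height, its last entry the head. Two configurations on the same input are consecutive if they are consecutive in the order $\le$ of the output string. A pebble transducer is a string-to-string MSO interpretation satisfying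 stack discipline: for any two consecutive configurations, either one pebble stack is a prefix of the other, or both stacks have equal length and agree except possibly on the last entry. A $k$-pebble transducer is a pebble transducer of dimension at most $k$. *)

(* Defs.v *)
From mathcomp Require Import all_boot.
Set Implicit Arguments. Unset Strict Implicit. Unset Printing Implicit Defensive.

(* Variables are named by natural numbers; first-order and set (monadic
   second-order) variables live in separate name spaces. *)
Inductive mso (Sigma : Type) : Type :=
| MLe   : nat -> nat -> mso Sigma
| MEq   : nat -> nat -> mso Sigma
| MLab  : Sigma -> nat -> mso Sigma
| MIn   : nat -> nat -> mso Sigma
| MNot  : mso Sigma -> mso Sigma
| MAnd  : mso Sigma -> mso Sigma -> mso Sigma
| MOr   : mso Sigma -> mso Sigma -> mso Sigma
| MEx1  : nat -> mso Sigma -> mso Sigma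
| MExS  : nat -> mso Sigma -> mso Sigma.

Definition upd {A : Type} (e : nat -> A) (x : nat) (v : A) : nat -> A :=
  fun y => if y == x then v else e y.

Fixpoint msat (Sigma : eqType) (w : seq Sigma) (nu : nat -> nat)
    (mu : nat -> nat -> bool) (phi : mso Sigma) : Prop :=
  match phi with
  | MLe x y => nu x <= nu y
  | MEq x y => nu x = nu y
  | MLab a x => nth None (map Some w) (nu x) = Some a
  | MIn x X => mu X (nu x)
  | MNot p => ~ msat w nu mu p
  | MAnd p q => msat w nu mu p /\ msat w nu mu q
  | MOr p q => msat w nu mu p \/ msat w nu mu q
  | MEx1 x p => exists i, i < size w /\ msat w (upd nu x i) mu p
  | MExS X p => exists S : nat -> bool, msat w nu (upd mu X S) p
  end.

(* A formula with free first-order variables x_1..x_d (variable names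
   0..d-1) evaluated at the tuple a. *)
Definition holds (Sigma : eqType) (w : seq Sigma) (phi : mso Sigma)
    (a : seq nat) : Prop :=
  msat w (fun i => nth 0 a i) (fun _ _ => false) phi.

Record interp (Sigma Gamma : Type) : Type := Interp {
  comp : finType;
  dim : comp -> nat;
  univ_f : comp -> mso Sigma;
  le_f : comp -> comp -> mso Sigma;
  lab_f : Gamma -> comp -> mso Sigma
}.

Section Interp.
Variables (Sigma : eqType) (Gamma : eqType) (I : interp Sigma Gamma).

Definition out_elem (w : seq Sigma) (e : comp I * seq nat) : Prop :=
  size e.2 = dim e.1 /\ all (fun i => i < size w) e.2 /\
  holds w (univ_f e.1) e.2.

Definition out_le (w : seq Sigma) (e e' : comp I * seq nat) : Prop :=
  holds w (le_f e.1 e'.1) (e.2 ++ e'.2).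

Definition out_lab (w : seq Sigma) (c : Gamma) (e : comp I * seq nat) : Prop :=
  holds w (lab_f c e.1) e.2.

(* I computes f: on every input w, the output structure is isomorphic to
   the string structure of f w (via the enumeration s of the universe). *)
Definition computes (f : seq Sigma -> seq Gamma) : Prop :=
  forall w, exists s : seq (comp I * seq nat),
    [/\ uniq s,
        (forall e, e \in s <-> out_elem w e),
        size s = size (f w),
        (forall e e', e \in s -> e' \in s ->
           (out_le w e e' <-> index e s <= index e' s)) &
        (forall e c, e \in s ->
           (out_lab w c e <-> nth c (f w) (index e s) = c))].

Definition consecutive (w : seq Sigma) (e e' : comp I * seq nat) : Prop :=
  [/\ out_elem w e, out_elem w e', e <> e', out_le w e e' &
      forall e'', out_elem w e'' -> e'' <> e -> e'' <> e' ->
        ~ (out_le w e e'' /\ out_le w e'' e')].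

Definition stack_ok (a b : seq nat) : Prop :=
  prefix a b \/ prefix b a \/
  (size a = size b /\ take (size a).-1 a = take (size b).-1 b).

Definition pebble_transducer : Prop :=
  forall w e e', consecutive w e e' -> stack_ok e.2 e'.2.

Definition dim_le (k : nat) : Prop := forall q : comp I, dim q <= k.

End Interp.

Definition polyregular (Sigma Gamma : eqType) (f : seq Sigma -> seq Gamma)
  : Prop := exists I : interp Sigma Gamma, computes I f.

Definition growth (Sigma : finType) (Gamma : Type)
    (f : seq Sigma -> seq Gamma) (n : nat) : nat :=
  \max_(m < n.+1) \max_(t : m.-tuple Sigma) size (f t).

Definition theta_n2 (g : nat -> nat) : Prop :=
  exists K N, 0 < K /\ forall n, N <= n -> n ^ 2 <= K * g n /\ g n <= K * n ^ 2.

(* Main.v *)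
Require Import Defs.
From mathcomp Require Import all_boot.
From mathcomp Require Import zify boolp.
Set Implicit Arguments. Unset Strict Implicit. Unset Printing Implicit Defensive.

(* The output of f on w lists the letters at x for all pairs (x, y) of positions
   of w. Separators of k levels turn w into a tree of depth k, and the pairs are
   visited by nested loops that descend alternately in the tree of x and in the
   tree of y, level by level. This takes dimension 2, but a pebble transducer
   has to hold one more pebble for every level.

   The hard inputs are trees whose leaves carry bit words of one MSO type, chosen
   so that each time a leaf word is output, some configuration has a pebble in
   that leaf (few choices of the word violate this, since the configurations
   avoiding the leaf do not depend on the word). Consider the window of output
   times at which x and y lie in fixed nodes of depth j, and suppose that the
   first j pebbles are fixed there. By compositionality of MSO, the values of
   pebble j+1 outside the node of x fall into boundedly many classes, all values
   of a class being combined in the window with the same positions of the node.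
   Since the window is short, a large class meets few of these positions; so most
   leaves are only met while pebble j+1 lies in the node of x or in a small
   class. There are fewer such values than subwindows, and a change of pebble j+1
   has to pass through a stack of height at most j+1; hence pebble j+1 is fixed
   in some subwindow of depth j+1. At depth k there is no pebble left. *)

(** * Recognizable languages and MSO *)

(** The map [h] need not be a morphism: factors with equal values are interchangeable in every
    context. One implication suffices, as [u] and [v] can be swapped. *)
Definition congruent (E : Type) (T : Type) (h : seq E -> T)
    (P : seq E -> Prop) : Prop :=
  forall u v, h u = h v -> forall l r, P (l ++ u ++ r) -> P (l ++ v ++ r).

Definition recognizable (E : Type) (P : seq E -> Prop) : Prop :=
  exists (T : finType) (h : seq E -> T), congruent h P.

Section Recognizable.
Variable E : Type.
Implicit Types P Q : seq E -> Prop.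

Lemma recognizable_has (g : pred E) : recognizable (fun u => has g u).
Proof.
by exists bool, (fun u => has g u) => u v huv l r; rewrite !has_cat huv.
Qed.

Lemma recognizable_count1 (g : pred E) : recognizable (fun u => count g u = 1).
Proof.
exists 'I_3, (fun u => inord (minn 2 (count g u))) => u v /(congr1 (@nat_of_ord 3)).
by rewrite !inordK ?ltnS ?geq_minl // => huv l r; rewrite !count_cat; lia.
Qed.

Lemma recognizable_not P : recognizable P -> recognizable (fun u => ~ P u).
Proof.
move=> [T [h hP]]; exists T, h => u v huv l r nP /hP Pu; apply: nP.
by apply: Pu.
Qed.

Lemma recognizable_and P Q :
  recognizable P -> recognizable Q -> recognizable (fun u => P u /\ Q u).
Proof.
move=> [T [h hP]] [T' [h' hQ]]; exists (T * T')%type, (fun u => (h u, h' u)).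
by move=> u v [huv huv'] l r [Pu Qu]; split; [apply: hP Pu | apply: hQ Qu].
Qed.

Lemma recognizable_or P Q :
  recognizable P -> recognizable Q -> recognizable (fun u => P u \/ Q u).
Proof.
move=> [T [h hP]] [T' [h' hQ]]; exists (T * T')%type, (fun u => (h u, h' u)).
move=> u v [huv huv'] l r [Pu | Qu].
- by left; apply: hP Pu.
- by right; apply: hQ Qu.
Qed.

Lemma recognizable_map (E' : Type) (g : E' -> E) P :
  recognizable P -> recognizable (fun u => P (map g u)).
Proof.
move=> [T [h hP]]; exists T, (fun u => h (map g u)) => u v huv l r.
by rewrite !map_cat; apply: hP.
Qed.

(* Powerset construction: a factor is abstracted to the set of values taken by
   all its extensions by a boolean track. *)
Lemma recognizable_track (P : seq (E * bool) -> Prop) :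
  recognizable P ->
  recognizable (fun u => exists t, size t = size u /\ P (zip u t)).
Proof.
move=> [T [h hP]].
pose H u := [set x : T | [exists t : (size u).-tuple bool, h (zip u t) == x]].
have HP u x : reflect (exists2 t, size t = size u & h (zip u t) = x) (x \in H u).
  rewrite inE; apply: (iffP existsP) => [[t /eqP ht]|[t /eqP st ht]].
    by exists t; rewrite ?size_tuple.
  by exists (Tuple st); rewrite ht.
exists {set T}, H => u v huv l r [t [st Pt]].
pose t1 := take (size l) t; pose t' := drop (size l) t.
pose t2 := take (size u) t'; pose t3 := drop (size u) t'.
have st1 : size t1 = size l.
  by rewrite size_takel // st size_cat leq_addr.
have st' : size t' = size u + size r by rewrite size_drop st !size_cat; lia.
have st2 : size t2 = size u by rewrite size_takel // st' leq_addr.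
have st3 : size t3 = size r by rewrite size_drop st'; lia.
have et : t = t1 ++ t2 ++ t3 by rewrite !cat_take_drop.
have /HP [t2' st2' ht2'] : h (zip u t2) \in H v.
  by rewrite -huv; apply/HP; exists t2.
exists (t1 ++ t2' ++ t3); split.
  by rewrite !size_cat st1 st2' st3.
move: Pt; rewrite et !zip_cat //.
by apply: hP.
Qed.

End Recognizable.

(** * MSO formulas define recognizable languages *)

Section Encoding.
Variable Sigma : eqType.

(* A letter together with the first-order and the second-order variables
   that hold at its position. *)
Definition mletter : Type := (Sigma * (nat -> bool) * (nat -> bool))%type.

(** The offset [o] is the position of the first letter of [w] inside a longer word, so that the
    encoding can be cut into factors. *)
Fixpoint enc (o : nat) (w : seq Sigma) (nu : nat -> nat)
    (mu : nat -> nat -> bool) : seq mletter :=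
  if w is a :: w' then
    (a, fun x => nu x == o, fun X => mu X o) :: enc o.+1 w' nu mu
  else [::].

Lemma size_enc o w nu mu : size (enc o w nu mu) = size w.
Proof. by elim: w o => //= a w IH o; rewrite IH. Qed.

Lemma enc_cat o u v nu mu :
  enc o (u ++ v) nu mu = enc o u nu mu ++ enc (o + size u) v nu mu.
Proof.
elim: u o => [|a u IH] o /=; first by rewrite addn0.
by rewrite IH addSnnS.
Qed.

Definition set_fo (x : nat) (e : mletter * bool) : mletter :=
  (e.1.1.1, fun y => if y == x then e.2 else e.1.1.2 y, e.1.2).

Definition set_so (X : nat) (e : mletter * bool) : mletter :=
  (e.1.1, fun Y => if Y == X then e.2 else e.1.2 Y).

Lemma enc_upd_fo o w nu mu x i :
  enc o w (upd nu x i) mu =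
  map (set_fo x) (zip (enc o w nu mu) [seq i == j | j <- iota o (size w)]).
Proof.
elim: w o => //= a w IH o; rewrite IH; congr cons; rewrite /set_fo /=.
by congr (_, _, _); apply/funext => y; rewrite /upd; case: ifP.
Qed.

Lemma enc_upd_so o w nu mu X (S : nat -> bool) :
  enc o w nu (upd mu X S) =
  map (set_so X) (zip (enc o w nu mu) [seq S j | j <- iota o (size w)]).
Proof.
elim: w o => //= a w IH o; rewrite IH; congr cons; rewrite /set_so /=.
by congr (_, _); apply/funext => y; rewrite /upd; case: ifP.
Qed.

(** Reduces first-order quantifiers to tracks: those with exactly one mark are the tracks of
    positions. *)
Lemma count1_track (t : seq bool) : count id t = 1 ->
  exists2 i, i < size t & t = [seq i == j | j <- iota 0 (size t)].
Proof.
move=> ct; have ht : has id t by rewrite has_count ct.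
exists (find id t); first by rewrite -has_find.
apply: (@eq_from_nth _ false) => [|i it]; first by rewrite size_map size_iota.
rewrite (nth_map 0) ?size_iota // nth_iota // add0n.
have ft : find id t < size t by rewrite -has_find.
case: eqP => [<-|ne]; first exact: (nth_find false ht).
apply/negbTE/negP => ti.
have lt : find id t < i.
  rewrite ltn_neqAle; apply/andP; split; first by apply/eqP.
  by rewrite leqNgt; apply/negP => /(before_find false); rewrite ti.
move: ct; rewrite -(cat_take_drop i t) count_cat.
have -> : count id (take i t) = (count id (take i t)).-1.+1.
  rewrite prednK // -has_count; apply/hasP; exists true => //.
  rewrite -(nth_find false ht) -(@nth_take i) //.
  by apply: mem_nth; rewrite size_takel // ltnW.
by rewrite (drop_nth false it) /= ti; lia.
Qed.

Lemma has_enc (g : pred mletter) o w nu mu :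
  has g (enc o w nu mu) <->
  exists i a, [/\ i < size w, nth None (map Some w) i = Some a &
    g (a, fun x => nu x == o + i, fun X => mu X (o + i))].
Proof.
elim: w o => [|b w IH] o /=; first by split=> [//|[? [? []]]].
split=> [/orP[gb|/IH [i [a [iw wi gi]]]]|[[|i] [a [iw wi gi]]]].
- by exists 0, b; rewrite addn0.
- by exists i.+1, a; rewrite addnS -addSn.
- by move: wi gi => [<-]; rewrite addn0 => ->.
- by apply/orP; right; apply/IH; exists i, a; rewrite addSn -addnS.
Qed.

(** Serves for the atom x <= y. The second test covers [e] itself because the order is reflexive. *)
Fixpoint before (g g' : pred mletter) (u : seq mletter) : bool :=
  if u is e :: u' then g e && has g' (e :: u') || before g g' u' else false.

Lemma before_cat g g' u v :
  before g g' (u ++ v) = [|| before g g' u, before g g' v | has g u && has g' v].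
Proof.
elim: u => [|e u IH] /=; first by rewrite orbF.
rewrite IH has_cat.
by case: (g e); case: (g' e); case: (has g' u); case: (has g u);
   case: (has g' v); case: (before g g' u); case: (before g g' v).
Qed.

Lemma recognizable_before g g' : recognizable (fun u => before g g' u).
Proof.
exists (bool * bool * bool)%type, (fun u => (before g g' u, has g u, has g' u)).
by move=> u v [h1 h2 h3] l r; rewrite !before_cat !has_cat h1 h2 h3.
Qed.

Definition at_fo (x : nat) : pred mletter := fun e => e.1.2 x.

Lemma has_at_fo o w nu mu x :
  has (at_fo x) (enc o w nu mu) = (o <= nu x < o + size w).
Proof.
elim: w o => [|a w IH] o /=; first by apply/esym/negbTE; lia.
rewrite IH /at_fo /=; apply/idP/idP; lia.
Qed.

Lemma before_enc o w nu mu x y :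
  before (at_fo x) (at_fo y) (enc o w nu mu) =
  [&& o <= nu x, nu x <= nu y & nu y < o + size w].
Proof.
elim: w o => [|a w IH] o /=; first by apply/esym/negbTE; lia.
rewrite IH has_at_fo /at_fo /=; apply/idP/idP; lia.
Qed.

Lemma nth_some (w : seq Sigma) i : i < size w ->
  exists a, nth None (map Some w) i = Some a.
Proof. by elim: w i => // a w IH [|i] //= iw; [exists a | apply: IH]. Qed.

(** Induction on the formula; a quantifier projects a track away. All variables must denote
    positions of [w], because the encoding shows no other value. *)
Lemma msat_recognizable (phi : mso Sigma) : exists P,
  recognizable P /\ forall w nu mu, (forall x, nu x < size w) ->
    (msat w nu mu phi <-> P (enc 0 w nu mu)).
Proof.
elim: phi => [x y|x y|a x|x X|p [P [rP hP]]|p [P [rP hP]] q [Q [rQ hQ]]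
  |p [P [rP hP]] q [Q [rQ hQ]]|x p [P [rP hP]]|X p [P [rP hP]]] /=.
- exists (fun u => before (at_fo x) (at_fo y) u).
  split; first exact: recognizable_before.
  by move=> w nu mu nuw; rewrite before_enc /= nuw andbT.
- exists (fun u => has (fun e => e.1.2 x && e.1.2 y) u).
  split; first exact: recognizable_has.
  move=> w nu mu nuw; split=> [exy|/has_enc [i [a [_ _ /=]]]].
    apply/has_enc; have [a wa] := nth_some (nuw x).
    by exists (nu x), a; split; rewrite //= add0n exy !eqxx.
  by rewrite add0n => /andP[/eqP -> /eqP ->].
- exists (fun u => has (fun e => e.1.2 x && (e.1.1 == a)) u).
  split; first exact: recognizable_has.
  move=> w nu mu nuw; split=> [wa|/has_enc [i [b [_ wb /=]]]].
    by apply/has_enc; exists (nu x), a; split; rewrite //= add0n !eqxx.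
  by rewrite add0n => /andP[/eqP -> /eqP <-].
- exists (fun u => has (fun e => e.1.2 x && e.2 X) u).
  split; first exact: recognizable_has.
  move=> w nu mu nuw; split=> [exy|/has_enc [i [a [_ _ /=]]]].
    apply/has_enc; have [a wa] := nth_some (nuw x).
    by exists (nu x), a; split; rewrite //= add0n exy !eqxx.
  by rewrite add0n => /andP[/eqP -> ].
- exists (fun u => ~ P u); split; first exact: recognizable_not.
  by move=> w nu mu nuw; have [h1 h2] := hP w nu mu nuw; split=> nP /[dup] // ?;
     [move/h2 => /nP | move/h1 => /nP].
- exists (fun u => P u /\ Q u); split; first exact: recognizable_and.
  move=> w nu mu nuw; split=> -[/(hP _ _ _ nuw) h1 /(hQ _ _ _ nuw) h2] //.
- exists (fun u => P u \/ Q u); split; first exact: recognizable_or.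
  move=> w nu mu nuw; split=> -[/(hP _ _ _ nuw)|/(hQ _ _ _ nuw)] h; by [left|right].
- exists (fun u => exists t, size t = size u /\
     (count snd (zip u t) = 1 /\ P (map (set_fo x) (zip u t)))).
  split.
    apply: (@recognizable_track _ (fun z => count snd z = 1 /\ P (map (set_fo x) z))).
    by apply: recognizable_and; [exact: recognizable_count1|exact: recognizable_map].
  move=> w nu mu nuw; have nuw' i : i < size w -> forall y, upd nu x i y < size w.
    by move=> iw y; rewrite /upd; case: ifP.
  have cz (t : seq bool) : size t = size w ->
      count snd (zip (enc 0 w nu mu) t) = count id t.
    by move=> st; rewrite -(count_map snd id) -/unzip2 unzip2_zip // size_enc st.
  split=> [[i [iw /(hP _ _ _ (nuw' i iw))]]|[t [st [ct Pt]]]].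
    rewrite enc_upd_fo; set t := map (eq_op i) _ => Pt.
    have st : size t = size w by rewrite /t size_map size_iota.
    exists t; rewrite size_enc cz //; split=> //; split=> //.
    by rewrite count_map -(@eq_count _ (pred1 i)) => [|j /=];
      rewrite ?count_uniq_mem ?iota_uniq ?mem_iota ?add0n ?iw // eq_sym.
  rewrite size_enc in st; rewrite cz // in ct.
  have [i it et] := count1_track ct; rewrite st in it et.
  exists i; split=> //; apply/(hP _ _ _ (nuw' i it)).
  by rewrite enc_upd_fo -et.
- exists (fun u => exists t, size t = size u /\ P (map (set_so X) (zip u t))).
  split.
    by apply: (@recognizable_track _ (fun z => P (map (set_so X) z)));
      exact: recognizable_map.
  move=> w nu mu nuw; split=> [[S /(hP _ _ _ nuw)]|[t [st Pt]]].
    rewrite enc_upd_so; set t := map S _ => Pt; exists t; split=> //.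
    by rewrite /t size_map size_iota size_enc.
  rewrite size_enc in st; exists (nth false t); apply/(hP _ _ _ nuw).
  by rewrite enc_upd_so -st map_nth_iota0 // take_size.
Qed.

End Encoding.

Lemma congruent_comp (E T T' : Type) (h : seq E -> T) (g : T' -> T)
    (h' : seq E -> T') P :
  (forall u, h u = g (h' u)) -> congruent h P -> congruent h' P.
Proof. by move=> hg hP u v huv; apply: hP; rewrite !hg huv. Qed.

Lemma recognizable_family (E : Type) (J : finType) (P : J -> seq E -> Prop) :
  (forall j, recognizable (P j)) ->
  exists (T : finType) (h : seq E -> T), forall j, congruent h (P j).
Proof.
move=> rP.
suff [T [h hP]] : exists (T : finType) (h : seq E -> T),
    forall j, j \in enum J -> congruent h (P j).
  by exists T, h => j; apply: hP; rewrite mem_enum.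
elim: (enum J) => [|j s [T [h hP]]]; first by exists unit, (fun _ => tt).
have [T' [h' hP']] := rP j.
exists (T' * T)%type, (fun u => (h' u, h u)) => i; rewrite inE.
case: eqP => [-> _|_ /= /hP hPi].
- exact: (congruent_comp (g := fst) _ hP').
- exact: (congruent_comp (g := snd) _ hPi).
Qed.

(** * Definable relations and compositionality *)

Section Definable.
Variable Sigma : eqType.
Implicit Types (w : seq Sigma) (l : seq nat) (R : seq Sigma -> seq nat -> Prop).

Definition enl (o : nat) w l := enc o w (nth 0 l) (fun _ _ => false).

(** Variables beyond [l] take the value 0, which is a position only if [w] is nonempty. *)
Definition represents (P : seq (mletter Sigma) -> Prop) n R : Prop :=
  forall w l, 0 < size w -> size l = n -> all (fun p => p < size w) l ->
    (R w l <-> P (enl 0 w l)).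

(* Semantic stand-in for "definable by an MSO formula with n free first-order
   variables"; it spares all renaming of bound variables. *)
Definition definable n R : Prop :=
  exists P, recognizable P /\ represents P n R.

Lemma enl_cat o u v l : enl o (u ++ v) l = enl o u l ++ enl (o + size u) v l.
Proof. exact: enc_cat. Qed.

Lemma eq_enl o w l l' :
  (forall i x, o <= i < o + size w -> (nth 0 l x == i) = (nth 0 l' x == i)) ->
  enl o w l = enl o w l'.
Proof.
rewrite /enl; elim: w o => //= a w IH o eql; congr cons.
  by congr (_, _, _); apply/funext => x; rewrite eql // leqnn; lia.
by apply: IH => i x io; apply: eql; lia.
Qed.

Lemma nth_all_lt l n x : 0 < n -> all (fun p => p < n) l -> nth 0 l x < n.
Proof.
move=> n0 /allP ln; have [xl|xl] := ltnP x (size l); first exact/ln/mem_nth.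
by rewrite nth_default.
Qed.

Lemma holds_recognizable (phi : mso Sigma) : exists P,
  recognizable P /\ forall n, represents P n (fun w l => holds w phi l).
Proof.
have [P [rP hP]] := msat_recognizable phi; exists P; split=> // n w l w0 _ lw.
by apply: hP => x; apply: nth_all_lt.
Qed.

Lemma definable_holds n (phi : mso Sigma) : definable n (fun w l => holds w phi l).
Proof.
by have [P [rP hP]] := holds_recognizable phi; exists P; split=> //; apply: hP.
Qed.

Lemma definable_and n R R' :
  definable n R -> definable n R' -> definable n (fun w l => R w l /\ R' w l).
Proof.
move=> [P [rP hP]] [Q [rQ hQ]]; exists (fun u => P u /\ Q u).
split; first exact: recognizable_and.
by move=> w l w0 sl lw; have := hP w l w0 sl lw; have := hQ w l w0 sl lw; tauto.
Qed.

Lemma all_nth_lt l r n : 0 < n -> all (fun p => p < n) l ->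
  all (fun p => p < n) [seq nth 0 l i | i <- r].
Proof. by move=> n0 ln; apply/allP => _ /mapP[i _ ->]; apply: nth_all_lt. Qed.

Lemma definable_select n (r : seq nat) R :
  definable (size r) R -> definable n (fun w l => R w [seq nth 0 l i | i <- r]).
Proof.
move=> [P [rP hP]].
(* A variable beyond [r] must get the value 0; variable [n] has it, as [l] has length [n]. *)
pose g (e : mletter Sigma) : mletter Sigma :=
  (e.1.1, fun x => e.1.2 (nth n r x), e.2).
exists (fun u => P (map g u)); split; first exact: recognizable_map.
move=> w l w0 sl lw; rewrite (hP w _ w0); last exact: all_nth_lt.
  suff H o : enl o w [seq nth 0 l i | i <- r] = map g (enl o w l) by rewrite H.
  rewrite /enl; elim: w o {w0 lw} => //= a w IH o; rewrite IH; congr cons.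
  rewrite /g /=; congr (_, _, _); apply/funext => x.
  have [xr|xr] := ltnP x (size r); first by rewrite (nth_map n).
  by rewrite nth_default ?size_map // (nth_default n) // -sl nth_default.
by rewrite size_map.
Qed.

Definition push (e : mletter Sigma * bool) : mletter Sigma :=
  (e.1.1.1, fun x => if x is y.+1 then e.1.1.2 y else e.2, e.1.2).

Lemma enl_cons o w l i :
  enl o w (i :: l) =
  map push (zip (enl o w l) [seq i == j | j <- iota o (size w)]).
Proof.
rewrite /enl; elim: w o => //= a w IH o; rewrite IH; congr cons.
by rewrite /push /=; congr (_, _, _); apply/funext => -[].
Qed.

Lemma definable_exists n R :
  definable n.+1 R ->
  definable n (fun w l => exists i, i < size w /\ R w (i :: l)).
Proof.
move=> [P [rP hP]].
exists (fun u => exists t, size t = size u /\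
  (count snd (zip u t) = 1 /\ P (map push (zip u t)))); split.
  apply: (@recognizable_track _ (fun z => count snd z = 1 /\ P (map push z))).
  by apply: recognizable_and; [exact: recognizable_count1|exact: recognizable_map].
move=> w l w0 sl lw.
have hPi i : i < size w -> R w (i :: l) <-> P (enl 0 w (i :: l)).
  by move=> iw; apply: hP => //=; rewrite ?sl ?iw.
have cz (t : seq bool) : size t = size w ->
    count snd (zip (enl 0 w l) t) = count id t.
  by move=> st; rewrite -(count_map snd id) -/unzip2 unzip2_zip // size_enc st.
split=> [[i [iw /(hPi _ iw)]]|[t [st [ct Pt]]]].
  rewrite enl_cons; set t := map (eq_op i) _ => Pt.
  have st : size t = size w by rewrite size_map size_iota.
  exists t; rewrite size_enc cz //; split=> //; split=> //.
  by rewrite count_map -(@eq_count _ (pred1 i)) => [|j /=];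
    rewrite ?count_uniq_mem ?iota_uniq ?mem_iota ?add0n ?iw // eq_sym.
rewrite size_enc in st; rewrite cz // in ct.
have [i it et] := count1_track ct; rewrite st in it et.
by exists i; split=> //; apply/(hPi _ it); rewrite enl_cons -et.
Qed.

Lemma definable_iff n R R' :
  (forall w l, size l = n -> R w l <-> R' w l) -> definable n R -> definable n R'.
Proof.
move=> RR' [P [rP hP]]; exists P; split=> // w l w0 sl lw.
by rewrite -RR' //; apply: hP.
Qed.

Lemma definable_exists_tuple d n R :
  definable (d + n) R ->
  definable n (fun w l => exists c, [/\ size c = d,
    all (fun p => p < size w) c & R w (c ++ l)]).
Proof.
elim: d R => [|d IH] R dR.
  apply: definable_iff dR => w l sl; split=> [Rl|[c [/size0nil -> _ //]]].
  by exists [::].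
have /IH := definable_exists dR; apply: definable_iff => w l sl.
split=> [[c [sc cw [i [iw Ri]]]]|[c []]].
  by exists (i :: c); rewrite /= sc iw.
case: c => // i c [sc] /= /andP[iw cw] Ri.
by exists c; split=> //; exists i.
Qed.

Lemma definable_family (J : finType) (n : J -> nat)
    (R : J -> seq Sigma -> seq nat -> Prop) :
  (forall j, definable (n j) (R j)) ->
  exists (T : finType) (h : seq (mletter Sigma) -> T), forall j, exists P,
    congruent h P /\ represents P (n j) (R j).
Proof.
move=> /choice [P hP].
have [T [h hh]] := recognizable_family (fun j => (hP j).1).
by exists T, h => j; exists (P j); split; [exact: hh | exact: (hP j).2].
Qed.

Definition bare (v : seq Sigma) : seq (mletter Sigma) :=
  [seq (a, fun=> false, fun=> false) | a <- v].

Definition avoids (o m : nat) l := all (fun p => ~~ (o <= p < o + m)) l.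

(** Variables beyond [l] all sit at position 0, so a factor that starts later and avoids [l] carries
    no mark at all. *)
Lemma enl_bare o v l : 0 < o -> avoids o (size v) l -> enl o v l = bare v.
Proof.
move=> o0 /allP lo.
have {lo} : forall x, ~~ (o <= nth 0 l x < o + size v).
  move=> x; have [xl|xl] := ltnP x (size l); first exact/lo/mem_nth.
  by rewrite nth_default //; lia.
rewrite /enl; elim: v o {o0} => //= a v IH o lo; congr cons.
  by congr (_, _, _); apply/funext => x; have := lo x; lia.
by apply: IH => x; have := lo x; lia.
Qed.

(** Used to exchange leaf words without affecting the configurations that avoid the leaf. *)
Lemma replace_factor (T : finType) (h : seq (mletter Sigma) -> T) P n R
    (L v v' r : seq Sigma) l :
  congruent h P -> represents P n R -> 0 < size L -> size v = size v' ->
  size l = n -> all (fun p => p < size (L ++ v ++ r)) l ->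
  avoids (size L) (size v) l -> h (bare v) = h (bare v') ->
  R (L ++ v ++ r) l -> R (L ++ v' ++ r) l.
Proof.
move=> hP PR L0 vv' sl lw lv hv.
have e1 : size (L ++ v' ++ r) = size (L ++ v ++ r) by rewrite !size_cat vv'.
have w0 : 0 < size (L ++ v ++ r) by rewrite size_cat ltn_addr.
move=> /(PR _ _ w0 sl lw) Pw; apply/PR; rewrite ?e1 //.
have eb x : size x = size v -> enl (0 + size L) x l = bare x.
  by move=> xv; rewrite enl_bare // xv.
by move: Pw; rewrite !enl_cat !eb // vv'; apply: hP.
Qed.

(* The two mark-dependent factors around the middle one determine, up to h,
   which middle positions are related to z. *)
Lemma move_outer_mark (T : finType) (h : seq (mletter Sigma) -> T) P n R
    (L U r : seq Sigma) z z' u u0 l (w := L ++ U ++ r)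
    (inU := fun p => size L <= p < size L + size U) :
  congruent h P -> represents P n.+2 R ->
  size l = n -> all (fun p => p < size w) l ->
  z < size w -> z' < size w -> ~~ inU z -> ~~ inU z' -> inU u -> inU u0 ->
  h (enl 0 L [:: z, u0 & l]) = h (enl 0 L [:: z', u0 & l]) ->
  h (enl (size L + size U) r [:: z, u0 & l]) =
    h (enl (size L + size U) r [:: z', u0 & l]) ->
  R w [:: z, u & l] -> R w [:: z', u & l].
Proof.
move=> hP PR sl lw zw z'w zU z'U uU u0U hL hr.
have uw : u < size w.
  by rewrite /w !size_cat; move: uU; rewrite /inU; lia.
have w0 : 0 < size w by lia.
(* Outside [U] the encoding does not see where in [U] the second mark lies, so [u0] can stand for
   every [u]; inside [U] it does not see [z]. *)
have eL y : enl 0 L [:: y, u & l] = enl 0 L [:: y, u0 & l].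
  by apply: eq_enl => i [|[|x]] //=; move: uU u0U; rewrite /inU; lia.
have er y : enl (size L + size U) r [:: y, u & l] =
            enl (size L + size U) r [:: y, u0 & l].
  by apply: eq_enl => i [|[|x]] //=; move: uU u0U; rewrite /inU; lia.
have eU : enl (size L) U [:: z, u & l] = enl (size L) U [:: z', u & l].
  by apply: eq_enl => i [|[|x]] //=; move: zU z'U; rewrite /inU; lia.
move=> /PR; rewrite /= sl zw uw lw => /(_ w0 erefl isT) Pz.
apply/PR; rewrite //= ?sl ?z'w ?uw //.
move: Pz; rewrite !enl_cat add0n eL er eU => /(hP _ _ hL [::]) /= Pz.
have := hP _ _ hr (enl 0 L [:: z', u0 & l] ++ enl (size L) U [:: z', u & l]) [::].
by rewrite !cats0 -!catA eL er; apply.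
Qed.

End Definable.

(** * The function *)

Fixpoint lexle (s t : seq nat) : bool :=
  match s, t with
  | [::], _ => true
  | _, [::] => false
  | x :: s', y :: t' => (x < y) || (x == y) && lexle s' t'
  end.

Lemma lexle_total : total lexle.
Proof. by elim=> [|x s IH] [|y t] //=; have := IH t; case: ltngtP. Qed.

Lemma lexle_trans : transitive lexle.
Proof.
elim=> [|y t IH] [|x s] [|z r] //=.
case/orP=> [xy|/andP[/eqP -> st]]; case/orP=> [yz|/andP[/eqP <- tr]].
- by rewrite (ltn_trans xy yz).
- by rewrite xy.
- by rewrite yz.
- by rewrite ltnn eqxx; apply: IH tr.
Qed.

Lemma lexle_anti s t : lexle s t -> lexle t s -> s = t.
Proof.
elim: s t => [|x s IH] [|y t] //=.
by case: ltngtP => // -> /= st ts; rewrite (IH t).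
Qed.

(** Having a given prefix is a convex condition; this makes the windows below intervals of output
    times. *)
Lemma lexle_sandwich n s t r :
  lexle s t -> lexle t r -> take n s = take n r -> size s = size t ->
  take n t = take n s.
Proof.
elim: n s t r => [|n IH] s t r; first by rewrite !take0.
case: s t r => [|x s] [|y t] [|z r] //= st tr [exz e] [est]; subst z.
by move: st tr; case: (ltngtP x y) => // -> /= st tr; rewrite (IH s t r).
Qed.

Section Squaring.
Variable k : nat.

Definition letter : finType := ('I_k + bool)%type.
Implicit Types (a : letter) (w : seq letter).

(** [inl i] is a separator of level [i]; bits get level [k], so that [cnt] ignores them for all j <=
    k. *)
Definition lvl a : nat := if a is inl i then i else k.

(** The number of the depth-[j] node around [x]. A node begins at its separator, hence [x.+1]. *)
Definition cnt w j x := count (fun a => lvl a < j) (take x.+1 w).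

(** The loop variables from the outermost to the innermost. The position x comes last, so that
    within a leaf the letters are output one after the other for a fixed y. *)
Definition key w (p : nat * nat) : seq nat :=
  flatten [seq [:: cnt w j p.1; cnt w j p.2] | j <- iota 1 k] ++ [:: p.2; p.1].

Definition pairle w p p' := lexle (key w p) (key w p').

Definition pairs w : seq (nat * nat) :=
  sort (pairle w) [seq (x, y) | x <- iota 0 (size w), y <- iota 0 (size w)].

Definition letter_at w i : letter := nth (inr false) w i.

(* The pairs of positions are listed in the order in which they are visited by
   2k+2 nested loops that refine x and y alternately, level by level. *)
Definition nested_squaring w : seq letter :=
  [seq letter_at w p.1 | p <- pairs w].

Lemma mem_pairs w p : (p \in pairs w) = (p.1 < size w) && (p.2 < size w).
Proof.
rewrite mem_sort; apply/allpairsP/andP => [[q [qx qy ->]]|[px py]].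
  by move: qx qy; rewrite !mem_iota.
by exists p; rewrite !mem_iota; split=> //; case: p {px py}.
Qed.

Lemma size_pairs w : size (pairs w) = size w ^ 2.
Proof. by rewrite size_sort size_allpairs !size_iota mulnn. Qed.

Lemma pairs_uniq w : uniq (pairs w).
Proof.
by rewrite sort_uniq; apply: allpairs_uniq; rewrite ?iota_uniq // => -[? ?] [].
Qed.

Lemma pairle_trans w : transitive (pairle w).
Proof. by move=> p q r; apply: lexle_trans. Qed.

Lemma pairle_refl w : reflexive (pairle w).
Proof. by move=> p; have := lexle_total (key w p) (key w p); rewrite orbb. Qed.

Lemma size_key w p : size (key w p) = 2 * k + 2.
Proof.
rewrite size_cat /=; congr (_ + _).
by rewrite -[in RHS](size_iota 1 k); elim: (iota 1 k) => //= j s ->; lia.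
Qed.

Lemma key_inj w : injective (key w).
Proof.
move=> [x y] [x' y'] /eqP; rewrite eqseq_cat; last first.
  by have := size_key w (x, y); have := size_key w (x', y'); rewrite !size_cat /=; lia.
by case/andP=> _ /eqP [-> ->].
Qed.

Lemma pairs_sorted w : sorted (pairle w) (pairs w).
Proof. by apply: sort_sorted => p q; apply: lexle_total. Qed.

Lemma index_pairs w p q : p \in pairs w -> q \in pairs w ->
  (index p (pairs w) <= index q (pairs w)) = pairle w p q.
Proof.
move=> pw qw.
have H := sorted_leq_index (@pairle_trans w) (@pairle_refl w) (pairs_sorted w).
apply/idP/idP => [|pq]; first exact: H.
rewrite leqNgt; apply/negP => ltqp.
have qp := H _ _ qw pw (ltnW ltqp).
have epq : p = q by apply: (@key_inj w); apply: lexle_anti.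
by rewrite epq ltnn in ltqp.
Qed.

Lemma cnt_mono w j x y : x <= y -> cnt w j x <= cnt w j y.
Proof.
move=> xy; rewrite /cnt -(@take_takel _ x.+1 y.+1) //.
by rewrite -[X in _ <= count _ X](cat_take_drop x.+1) count_cat leq_addr.
Qed.

(** Turns a comparison of counts into a first-order condition. *)
Lemma cnt_ltP w j x y : y < size w ->
  (cnt w j x < cnt w j y) <->
  exists z, [/\ x < z, z <= y & lvl (letter_at w z) < j].
Proof.
move=> yw; have [yx|xy] := leqP y x.
  split=> [|[z []]]; last by lia.
  by have := cnt_mono w j yx; lia.
have -> : cnt w j x < cnt w j y =
    has (fun a => lvl a < j) (drop x.+1 (take y.+1 w)).
  have e : take x.+1 w = take x.+1 (take y.+1 w).
    by rewrite take_takel //; apply: ltnW.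
  rewrite has_count /cnt e -[X in _ < count _ X](cat_take_drop x.+1) count_cat.
  by rewrite -[X in X < _]addn0 ltn_add2l.
have sd : size (drop x.+1 (take y.+1 w)) = y - x.
  by rewrite size_drop size_takel // subSS.
split=> [/(has_nthP (inr false))[i]|[z [xz zy wz]]].
  rewrite sd => iyx; rewrite nth_drop nth_take; last by lia.
  by exists (x.+1 + i); split=> //; lia.
apply/(has_nthP (inr false)); exists (z - x.+1); rewrite ?sd ?nth_drop; first lia.
by rewrite subnKC // nth_take.
Qed.

(** * An MSO formula for the order on pairs *)

Definition MFalse : mso letter := MNot (MEq _ 0 0).
Definition MLt x y : mso letter := MNot (MLe _ y x).

Definition lvl_lt_mso j z : mso letter :=
  foldr (fun a p => MOr (MLab a z) p) MFalse [seq a <- enum letter | lvl a < j].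

(** Variables 0, 1 and 2, 3 hold the two pairs to be compared, so 4 is free for the bound
    position. *)
Definition cnt_lt_mso j x y : mso letter :=
  MEx1 4 (MAnd (MLt x 4) (MAnd (MLe _ 4 y) (lvl_lt_mso j 4))).

Definition cnt_eq_mso j x y : mso letter :=
  MAnd (MNot (cnt_lt_mso j x y)) (MNot (cnt_lt_mso j y x)).

Definition lex_mso (c : mso letter * mso letter) (p : mso letter) : mso letter :=
  MOr c.1 (MAnd c.2 p).

Definition pairle_mso : mso letter :=
  foldr lex_mso (MEq _ 0 0)
   (flatten [seq [:: (cnt_lt_mso j 0 2, cnt_eq_mso j 0 2);
                     (cnt_lt_mso j 1 3, cnt_eq_mso j 1 3)] | j <- iota 1 k] ++
    [:: (MLt 1 3, MEq _ 1 3); (MLt 0 2, MEq _ 0 2)]).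

Lemma nth_map_some w i a : nth None (map Some w) i = Some a <->
  i < size w /\ letter_at w i = a.
Proof.
have [iw|iw] := ltnP i (size w); last first.
  by rewrite nth_default ?size_map //; split=> // -[].
by rewrite (nth_map (inr false)) //; split=> [[<-]|[_ <-]].
Qed.

Lemma msat_lvl_lt w nu mu j z : nu z < size w ->
  msat w nu mu (lvl_lt_mso j z) <-> lvl (letter_at w (nu z)) < j.
Proof.
move=> zw; set a := letter_at w (nu z).
have -> : (lvl a < j) = (a \in [seq a <- enum letter | lvl a < j]).
  by rewrite mem_filter mem_enum andbT.
rewrite /lvl_lt_mso; elim: [seq a <- _ | _] => [|b s IH] /=.
  by split=> // h; case: h.
rewrite inE; split=> [[/nth_map_some[_ <-]|/IH ->]|/orP[/eqP <-|/IH]].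
- by rewrite eqxx.
- by rewrite orbT.
- by left; apply/nth_map_some.
- by right.
Qed.

Lemma msat_cnt_lt w nu mu j x y : x != 4 -> y != 4 -> nu y < size w ->
  msat w nu mu (cnt_lt_mso j x y) <-> cnt w j (nu x) < cnt w j (nu y).
Proof.
move=> x4 y4 yw; rewrite (cnt_ltP _ _ yw) /=.
split=> [[z [zw]]|[z [xz zy wz]]].
  rewrite {1 2 3 4}/upd /= (negbTE x4) (negbTE y4) => -[xz [zy /msat_lvl_lt]] /=.
  by rewrite /upd eqxx => /(_ zw) wz; exists z; split=> //; lia.
have zw : z < size w by lia.
exists z; split=> //; rewrite {1 2 3 4}/upd /= (negbTE x4) (negbTE y4).
split; first by lia.
split=> //; apply/msat_lvl_lt; by rewrite /upd eqxx.
Qed.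

Lemma msat_cnt_eq w nu mu j x y : x != 4 -> y != 4 ->
  nu x < size w -> nu y < size w ->
  msat w nu mu (cnt_eq_mso j x y) <-> cnt w j (nu x) = cnt w j (nu y).
Proof.
move=> x4 y4 xw yw; rewrite /cnt_eq_mso.
have h1 := @msat_cnt_lt w nu mu j x y x4 y4 yw.
have h2 := @msat_cnt_lt w nu mu j y x y4 x4 xw.
split=> [[n1 n2]|e].
  have m1 : ~ (cnt w j (nu x) < cnt w j (nu y)) by move/h1.
  have m2 : ~ (cnt w j (nu y) < cnt w j (nu x)) by move/h2.
  by lia.
by split=> [/h1|/h2]; rewrite e ltnn.
Qed.

Lemma msat_lex w nu mu c p x y s t :
  (msat w nu mu c.1 <-> x < y) -> (msat w nu mu c.2 <-> x = y) ->
  (msat w nu mu p <-> lexle s t) ->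
  msat w nu mu (lex_mso c p) <-> lexle (x :: s) (y :: t).
Proof.
move=> h1 h2 h3 /=; split=> [[/h1 -> //|[/h2 -> /h3 ->]]|].
  by rewrite eqxx orbT.
by case/orP=> [/h1|/andP[/eqP/h2 ? /h3 ?]]; [left | right].
Qed.

Lemma holds_pairle w p q : p \in pairs w -> q \in pairs w ->
  holds w pairle_mso [:: p.1; p.2; q.1; q.2] <-> pairle w p q.
Proof.
rewrite !mem_pairs => /andP[px py] /andP[qx qy].
rewrite /holds /pairle /key /pairle_mso.
elim: (iota 1 k) => [|j s IH].
  apply: msat_lex; [by rewrite /=; lia|by []|].
  by apply: msat_lex; [rewrite /=; lia|by []|].
apply: msat_lex; [exact: msat_cnt_lt|exact: msat_cnt_eq|].
by apply: msat_lex; [exact: msat_cnt_lt|exact: msat_cnt_eq|].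
Qed.

Definition squaring_interp : interp letter letter :=
  @Interp letter letter unit (fun=> 2) (fun=> MEq _ 0 0)
    (fun _ _ => pairle_mso) (fun a _ => MLab a 0).

Definition pair_conf (p : nat * nat) : unit * seq nat := (tt, [:: p.1; p.2]).

Lemma pair_conf_inj : injective pair_conf.
Proof. by move=> [x y] [x' y'] [-> ->]. Qed.

Lemma polyregular_squaring : polyregular nested_squaring.
Proof.
exists squaring_interp => w; exists (map pair_conf (pairs w)).
have inj := pair_conf_inj.
split.
- by rewrite map_inj_uniq // pairs_uniq.
- move=> [[] l]; split=> [/mapP[p]|[/= sl [lw _]]].
    rewrite mem_pairs => /andP[px py] [->].
    by split=> //; split=> //=; rewrite px py.
  case: l sl lw => [|x [|y []]] //= _ /and3P[xw yw _].
  by apply/mapP; exists (x, y); rewrite ?mem_pairs //= xw.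
- by rewrite !size_map.
- move=> _ _ /mapP[p pw ->] /mapP[q qw ->].
  by rewrite !index_map // index_pairs //; apply: holds_pairle.
- move=> _ a /mapP[p pw ->]; rewrite index_map //.
  rewrite /nested_squaring (nth_map (0, 0)) ?index_mem // nth_index //.
  rewrite /out_lab /holds /= nth_map_some.
  by move: pw; rewrite mem_pairs => /andP[-> _]; split=> [[]|].
Qed.

Lemma size_squaring w : size (nested_squaring w) = size w ^ 2.
Proof. by rewrite size_map size_pairs. Qed.

Lemma growth_squaring n : growth nested_squaring n = n ^ 2.
Proof.
apply/eqP; rewrite eqn_leq; apply/andP; split.
  apply/bigmax_leqP => m _; apply/bigmax_leqP => t _.
  by rewrite size_squaring size_tuple leq_exp2r // -ltnS.
apply: leq_trans (leq_bigmax (@ord_max n)).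
apply: leq_trans (leq_bigmax (nseq_tuple n (inr false : letter))).
by rewrite size_squaring size_tuple.
Qed.

Lemma theta_n2_growth_squaring : theta_n2 (growth nested_squaring).
Proof. by exists 1, 0; split=> // n _; rewrite growth_squaring mul1n leqnn. Qed.

End Squaring.

(** * Tree words *)

Lemma lexle_cat2l s t u : lexle (s ++ t) (s ++ u) = lexle t u.
Proof. by elim: s => //= x s ->; rewrite ltnn eqxx. Qed.

Lemma count_dvdn d n : 0 < d -> count (fun p => d %| p) (iota 0 n.+1) = (n %/ d).+1.
Proof.
move=> d0; elim: n => [|n IH]; first by rewrite /= dvdn0 div0n.
by rewrite -addn1 iotaD count_cat IH /= add0n addn0 divnS // addnC addnS.
Qed.

Section TreeWords.
Variables (k' s : nat) (M : nat -> nat).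
Local Notation k := k'.+1.
Local Notation N := (M 0).
Hypothesis Mk : M k = s.+1.
Hypothesis M_gt0 : forall j, j <= k -> 0 < M j.
Hypothesis M_dvd : forall i j, i <= j -> j <= k -> M j %| M i.
Implicit Type ids : nat -> seq bool.

(* Position p is a node of depth j exactly when M j divides p; the separator
   there carries the least such depth, and the s positions after the t-th
   multiple of s.+1 carry the word ids t. *)
Definition tree_letter ids p : letter k :=
  if s.+1 %| p then inl (inord (find (fun j => M j.+1 %| p) (iota 0 k)))
  else inr (nth false (ids (p %/ s.+1)) (p %% s.+1).-1).

Definition tree_word ids : seq (letter k) := mkseq (tree_letter ids) N.

Lemma size_tree_word ids : size (tree_word ids) = N.
Proof. exact: size_mkseq. Qed.

(** In a divisor chain the depths at which [p] begins a node are upward closed, so only the least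
    one counts. Level [i] stands for depth [i.+1], hence the strict inequality. *)
Lemma lvl_tree_letter ids j p : 0 < j <= k ->
  (lvl (tree_letter ids p) < j) = (M j %| p).
Proof.
move=> /andP[j0 jk]; rewrite /tree_letter; case: ifP => sp; last first.
  rewrite [lvl _]/= ltnNge jk; apply/esym/negbTE.
  by apply: contraFN sp => jp; rewrite -Mk (dvdn_trans _ jp) // M_dvd.
set P := fun j => _.
have hP : has P (iota 0 k).
  by apply/hasP; exists k'; rewrite ?mem_iota //= /P Mk.
have fk : find P (iota 0 k) < k by rewrite -[X in _ < X](size_iota 0) -has_find.
rewrite [lvl _]/= inordK //; apply/idP/idP => [fj|jp].
  have := nth_find 0 hP; rewrite nth_iota // add0n /P.
  by apply: dvdn_trans; apply: M_dvd.
rewrite ltnNge; apply/negP => jf.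
have := @before_find _ 0 P (iota 0 k) j.-1.
rewrite nth_iota; last by lia.
by rewrite add0n /P prednK // jp => /(_ _); rewrite jf => /(_ isT).
Qed.

(** Position 0 already carries a separator, hence the successor. *)
Lemma cnt_tree_word ids j x : 0 < j <= k -> x < N ->
  cnt (tree_word ids) j x = (x %/ M j).+1.
Proof.
move=> jk xN; rewrite -count_dvdn; last by apply: M_gt0; case/andP: jk.
rewrite /cnt /tree_word /mkseq -map_take count_map take_iota.
rewrite (_ : minn _ _ = x.+1); last by apply/minn_idPl.
by apply: eq_count => p /=; apply: lvl_tree_letter.
Qed.

Definition key_prefix j (p : nat * nat) : seq nat :=
  flatten [seq [:: (p.1 %/ M i).+1; (p.2 %/ M i).+1] | i <- iota 1 j].

Lemma key_tree_word ids p : p.1 < N -> p.2 < N ->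
  key (tree_word ids) p = key_prefix k p ++ [:: p.2; p.1].
Proof.
move=> p1 p2; rewrite /key /key_prefix; congr (flatten _ ++ _).
by apply/eq_in_map => j; rewrite mem_iota => jk; rewrite !cnt_tree_word //; lia.
Qed.

Lemma size_key_prefix j p : size (key_prefix j p) = 2 * j.
Proof.
rewrite /key_prefix -[in RHS](size_iota 1 j).
by elim: (iota 1 j) => //= i l ->; lia.
Qed.

Lemma key_prefix_eq j p q : j <= k ->
  p.1 %/ M j = q.1 %/ M j -> p.2 %/ M j = q.2 %/ M j ->
  key_prefix j p = key_prefix j q.
Proof.
move=> jk e1 e2; congr flatten; apply/eq_in_map => i.
rewrite mem_iota add1n ltnS => /andP[_ ij].
have [m em] := dvdnP (M_dvd ij jk).
by rewrite em mulnC !divnMA e1 e2.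
Qed.

Lemma key_prefix_inj j p q : 0 < j -> key_prefix j p = key_prefix j q ->
  p.1 %/ M j = q.1 %/ M j /\ p.2 %/ M j = q.2 %/ M j.
Proof.
case: j => // j _; have iE : iota 1 j.+1 = iota 1 j ++ [:: j.+1].
  by rewrite -[in LHS](addn1 j) iotaD add1n.
rewrite /key_prefix iE !map_cat !flatten_cat => /eqP.
rewrite eqseq_cat; last by rewrite !size_key_prefix.
by case/andP=> _ /eqP [-> ->].
Qed.

Lemma take_key_prefix j l p : j <= l -> take (2 * j) (key_prefix l p) = key_prefix j p.
Proof.
move=> jl; rewrite /key_prefix -(subnKC jl) iotaD map_cat flatten_cat.
by rewrite take_size_cat // size_key_prefix.
Qed.

(** For positive [j] the first [2 * j] entries of the key and the two nodes of depth [j] determine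
    each other, so [lexle_sandwich] applies. At depth 0 all quotients vanish. *)
Lemma pairs_convex ids j p q r : j <= k ->
  p \in pairs (tree_word ids) -> q \in pairs (tree_word ids) ->
  r \in pairs (tree_word ids) ->
  pairle (tree_word ids) p q -> pairle (tree_word ids) q r ->
  p.1 %/ M j = r.1 %/ M j -> p.2 %/ M j = r.2 %/ M j ->
  q.1 %/ M j = p.1 %/ M j /\ q.2 %/ M j = p.2 %/ M j.
Proof.
move=> jk; rewrite !mem_pairs size_tree_word.
move=> /andP[p1 p2] /andP[q1 q2] /andP[r1 r2] pq qr e1 e2.
case: j jk e1 e2 => [|j] jk e1 e2; first by rewrite !divn_small.
apply: key_prefix_inj => //.
have tk x : x.1 < N -> x.2 < N ->
    take (2 * j.+1) (key (tree_word ids) x) = key_prefix j.+1 x.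
  move=> x1 x2; rewrite key_tree_word // takel_cat ?take_key_prefix //.
  by rewrite size_key_prefix leq_mul2l.
rewrite -!tk //; apply: lexle_sandwich pq qr _ _; rewrite ?size_key //.
by rewrite !tk //; apply: key_prefix_eq.
Qed.

Lemma take_key_tree_word ids p : p.1 < N -> p.2 < N ->
  take (2 * k).+1 (key (tree_word ids) p) = key_prefix k p ++ [:: p.2].
Proof.
move=> p1 p2; rewrite key_tree_word // -cat1s catA take_size_cat //.
by rewrite size_cat size_key_prefix addn1.
Qed.

(** [x] and [x.+1] lie in one leaf, so the two keys differ in their last entry only and no key fits
    in between. *)
Lemma index_pairs_succ ids x y : x < N -> y < N -> x %% s.+1 < s ->
  x.+1 < N /\ index (x.+1, y) (pairs (tree_word ids)) =
              (index (x, y) (pairs (tree_word ids))).+1.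
Proof.
move=> xN yN xs; set w := tree_word ids.
have dN : s.+1 %| N by rewrite -Mk M_dvd.
have dx : x.+1 %/ s.+1 = x %/ s.+1.
  have xs0 : (x %% s.+1).+1 %/ s.+1 = 0 by rewrite divn_small.
  by rewrite {1}(divn_eq x s.+1) -addnS divnMDl // xs0 addn0.
have x1N : x.+1 < N.
  rewrite -(divnK dN) -ltn_divLR // dx ltn_divLR // divnK //.
split=> //.
have mp z : z < N -> (z, y) \in pairs w.
  by move=> zN; rewrite mem_pairs size_tree_word zN.
have kp : key_prefix k (x, y) = key_prefix k (x.+1, y).
  by apply: key_prefix_eq => //=; rewrite Mk dx.
have K z : z < N -> key w (z, y) = key_prefix k (z, y) ++ [:: y; z].
  by move=> zN; rewrite key_tree_word.
have pqle : pairle w (x, y) (x.+1, y).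
  rewrite /pairle !K // kp lexle_cat2l /= eqxx ltnn /=.
  by rewrite ltnSn.
have lt : index (x, y) (pairs w) < index (x.+1, y) (pairs w).
  rewrite ltn_neqAle index_pairs ?mp // pqle andbT; apply/eqP => e.
  have := nth_index (0, 0) (mp _ xN); rewrite e nth_index ?mp // => -[].
  by lia.
(* A pair [r] at the next index would share all key entries but the last with [(x, y)], which leaves
   only [x] and [x.+1] for [r.1]. *)
apply/eqP; rewrite eqn_leq lt andbT leqNgt; apply/negP => lt2.
set i := (index (x, y) (pairs w)).+1 in lt2 *.
have ip : i < size (pairs w).
  by apply: ltn_trans lt2 _; rewrite index_mem mp.
pose r := nth (0, 0) (pairs w) i.
have rp : r \in pairs w by apply: mem_nth.
have ri : index r (pairs w) = i by rewrite index_uniq ?pairs_uniq.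
have pr : pairle w (x, y) r by rewrite -index_pairs ?mp // ri.
have rq : pairle w r (x.+1, y) by rewrite -index_pairs ?mp // ri ltnW.
have [r1 r2] : r.1 < N /\ r.2 < N.
  by move: rp; rewrite mem_pairs size_tree_word => /andP.
have : take (2 * k).+1 (key w r) = take (2 * k).+1 (key w (x, y)).
  apply: lexle_sandwich pr rq _ _; rewrite ?size_key //.
  by rewrite !take_key_tree_word // kp.
rewrite !take_key_tree_word // => /eqP.
rewrite eqseq_cat ?size_key_prefix // => /andP[/eqP ek /eqP [ey]].
move: pr rq; rewrite /pairle !K // key_tree_word // -kp ek ey !lexle_cat2l /=.
rewrite !eqxx !ltnn /= !andbT => h1 h2.
have : r.1 = x \/ r.1 = x.+1 by lia.
rewrite [r]surjective_pairing ey in ri.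
case=> e; move: ri lt lt2; rewrite e /i; lia.
Qed.

Lemma index_pairs_run ids t y d : t < N %/ s.+1 -> y < N -> d <= s ->
  t * s.+1 + d < N /\
  index (t * s.+1 + d, y) (pairs (tree_word ids)) =
    index (t * s.+1, y) (pairs (tree_word ids)) + d.
Proof.
move=> tN yN; elim: d => [|d IH] ds.
  by rewrite !addn0 -ltn_divRL // -Mk M_dvd.
have [xN ei] := IH (ltnW ds).
have xs : (t * s.+1 + d) %% s.+1 < s by rewrite modnMDl modn_small // ltnW.
by have [] := index_pairs_succ ids xN yN xs; rewrite !addnS ei.
Qed.

(** Exhibits the word of leaf [t] as a factor that can be replaced while the rest stays. *)
Lemma tree_word_split ids ids' t : t < N %/ s.+1 -> size (ids' t) = s ->
  (forall u, u <> t -> ids' u = ids u) ->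
  tree_word ids' =
    take (t * s.+1).+1 (tree_word ids) ++ map inr (ids' t) ++
    drop ((t * s.+1).+1 + s) (tree_word ids).
Proof.
move=> tN st eids; set o := (t * s.+1).+1.
have oN : o + s <= N.
  have dN : s.+1 %| N by rewrite -Mk M_dvd.
  by rewrite /o addSnnS -mulSnr -leq_divRL.
have sl : size (take o (tree_word ids)) = o.
  by rewrite size_takel // size_tree_word; lia.
apply: (@eq_from_nth _ (inr false)).
  by rewrite !size_cat sl size_map st size_drop !size_tree_word; lia.
rewrite size_tree_word => p pN; rewrite !nth_cat sl size_map st nth_mkseq //.
have same : p %/ s.+1 <> t \/ s.+1 %| p -> tree_letter ids' p = nth (inr false) (tree_word ids) p.
  rewrite nth_mkseq // /tree_letter; case: ifP => // dp [ne|//].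
  by rewrite eids.
have [po|op] := ltnP p o.
  rewrite nth_take // same //.
  have [->|ne] := eqVneq p (t * s.+1); first by right; rewrite dvdn_mull.
  left => e; move: (leq_trunc_div p s.+1); rewrite e; move/eqP: ne; lia.
have [pos|osp] := ltnP (p - o) s; last first.
  rewrite nth_drop same; last first.
    left => e; have := ltn_ceil p (ltn0Sn s); rewrite e; rewrite /o in osp; lia.
  by congr (nth _ _ _); lia.
have pE : p = t * s.+1 + (p - o).+1 by rewrite /o; lia.
have pd : p %/ s.+1 = t by rewrite pE divnMDl // divn_small // addn0.
have pm : p %% s.+1 = (p - o).+1 by rewrite {1}pE modnMDl modn_small.
rewrite (nth_map false) ?st // /tree_letter pd pm /dvdn pm /=.
by [].
Qed.

End TreeWords.

(** * Descent through the windows *)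

Lemma card_le_inj_in (T U : finType) (A : {set T}) (B : {set U}) (g : T -> U) :
  {in A &, injective g} -> {in A, forall x, g x \in B} -> #|A| <= #|B|.
Proof.
move=> gI gB; rewrite -(card_in_imset gI); apply: subset_leq_card.
by apply/subsetP => _ /imsetP[x xA ->]; apply: gB.
Qed.

Lemma card_bigcup_le (I T : finType) (S : {pred I}) (F : I -> {set T}) :
  #|\bigcup_(i in S) F i| <= \sum_(i in S) #|F i|.
Proof.
elim/big_ind2: _ => [|m X m' Y h h'|] //; first by rewrite cards0.
by rewrite (leq_trans (leq_card_setU _ _)) // leq_add.
Qed.

Lemma card_cover_le (I T : finType) (A : {set T}) (W : {set I})
    (F : I -> {set T}) k :
  {in A, forall x, exists2 i, i \in W & x \in F i} ->
  (forall i, i \in W -> #|F i| <= k) -> #|A| <= #|W| * k.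
Proof.
move=> AF Fk; apply: (@leq_trans (\sum_(i in W) #|F i|)).
  apply: (@leq_trans #|\bigcup_(i in W) F i|).
    apply: subset_leq_card; apply/subsetP => x /AF[i iW xi].
    by apply/bigcupP; exists i.
  exact: card_bigcup_le.
by rewrite -sum_nat_const; apply: leq_sum.
Qed.

Lemma card_divn_fiber N m a : 0 < m -> #|[set z : 'I_N | z %/ m == a]| <= m.
Proof.
move=> m0; rewrite -[X in _ <= X]card_ord -cardsT.
apply: (card_le_inj_in (g := fun z : 'I_N => Ordinal (ltn_pmod z m0))) => // z z'.
rewrite !inE => /eqP za /eqP za' /(congr1 val) /= e.
by apply: val_inj; rewrite /= (divn_eq z m) (divn_eq z' m) za za' e.
Qed.

Lemma stack_ok_sym s t : stack_ok s t -> stack_ok t s.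
Proof. by case=> [|[|[]]]; rewrite /stack_ok; auto. Qed.

(** Only the head may move. Entry [j] is below the head of [s], so it survives if [t] is high enough
    to contain it. *)
Lemma stack_ok_nth j s t : stack_ok s t -> j.+1 < size s -> j < size t ->
  nth 0 t j = nth 0 s j.
Proof.
case=> [/prefixP[r ->]|[/prefixP[r ->]|[st e]]] js jt.
- by rewrite nth_cat ltnW.
- by rewrite nth_cat jt.
have := congr1 (fun x => nth 0 x j) e.
rewrite /= nth_take; last by rewrite -subn1 ltn_subRL add1n.
by rewrite nth_take // -st -subn1 ltn_subRL add1n.
Qed.

Lemma interval_propagate (P : nat -> Prop) i1 i2 i0 i :
  i1 <= i0 <= i2 -> i1 <= i <= i2 -> P i0 ->
  (forall i, i1 <= i -> i.+1 <= i2 -> P i <-> P i.+1) -> P i.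
Proof.
move=> h0 hi P0 step.
have up d : i0 + d <= i2 -> P (i0 + d).
  elim: d => [|d IH]; rewrite ?addn0 // addnS => le.
  by apply: (step _ _ _).1; [lia|lia|apply: IH; lia].
have down d : i1 + d <= i0 -> P (i0 - d).
  elim: d => [|d IH] le; rewrite ?subn0 //.
  have e : (i0 - d.+1).+1 = i0 - d by lia.
  by apply: (step _ _ _).2; rewrite ?e; [lia|lia|apply: IH; lia].
have [le|lt] := leqP i0 i.
  by rewrite -(subnKC le); apply: up; lia.
by have -> : i = i0 - (i0 - i) by [lia]; apply: down; lia.
Qed.

Section Descent.
Variables (Q : finType) (k N K : nat) (M : nat -> nat).
(* cfg i is the i-th configuration of the run, pr i the pair of input
   positions that the i-th output position corresponds to. *)
Variables (cfg : nat -> Q * seq nat) (pr : nat -> nat * nat).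
Local Notation stack i := (cfg i).2.
Local Notation T := (N ^ 2).

(** The two summands pay, in the bound [lowN] below, for the low configurations outside the small
    classes and for the bad children. *)
Definition growth_factor := 8 * #|Q| + 16 * #|Q| * K ^ 2 * k.
Local Notation c := growth_factor.

Definition window j a b i :=
  [&& i < T, (pr i).1 %/ M j == a & (pr i).2 %/ M j == b].

(** Entries are numbered from 0, so the pebble at [z] is pebble [j.+1]. *)
Definition visits j i1 i2 z u := exists i,
  [/\ i1 <= i <= i2, j < size (stack i), nth 0 (stack i) j = z & u \in stack i].

Hypothesis K_gt0 : 0 < K.
Hypothesis M0 : M 0 = N.
Hypothesis MS : forall j, j < k -> M j = c * M j.+1 ^ 3.
Hypothesis Mk_gt0 : 0 < M k.
Hypothesis cfg_inj : forall i i', i < T -> i' < T -> cfg i = cfg i' -> i = i'.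
Hypothesis cfg_pos : forall i, i < T -> all (fun p => p < N) (stack i).
Hypothesis cfg_dim : forall i, i < T -> size (stack i) <= k.
Hypothesis cfg_stack : forall i, i.+1 < T -> stack_ok (stack i) (stack i.+1).
Hypothesis pr_inj : forall i i', i < T -> i' < T -> pr i = pr i' -> i = i'.
Hypothesis convex : forall j a b i1 i i2, j <= k -> i1 <= i <= i2 ->
  window j a b i1 -> window j a b i2 -> window j a b i.
Hypothesis touch : forall j a b, 0 < j <= k -> a < N %/ M j -> b < N %/ M j ->
  exists i, window j a b i /\ exists2 u, u \in stack i & u %/ M j = a.
Hypothesis rows : forall j i1 i2 a, j < k -> i1 < T -> i2 < T ->
  a < N %/ M j -> exists theta : nat -> 'I_K,
  forall z z', z < N -> z' < N -> z %/ M j <> a -> z' %/ M j <> a ->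
    theta z = theta z' ->
  forall u, u %/ M j = a -> visits j i1 i2 z u -> visits j i1 i2 z' u.

Lemma level_gt0 j : j <= k -> 0 < M j.
Proof.
move=> jk; rewrite -(subKn jk); elim: (k - j) (leq_subr j k) => [|d IH] dk.
  by rewrite subn0.
rewrite MS; last by lia.
have -> : (k - d.+1).+1 = k - d by lia.
have Md : 0 < M (k - d) by apply: IH; lia.
rewrite muln_gt0 expn_gt0 Md andbT.
suff : 0 < #|Q| by rewrite /c; lia.
have [N0|N0] := posnP N; last first.
  by apply/card_gt0P; exists (cfg 0).1.
by apply/card_gt0P; exists (cfg 0).1.
Qed.

(** The window splits into [n ^ 2] subwindows. Discard those whose child of [a] is met by a large
    class and those containing a configuration in [Low]; fewer than [n ^ 2] are lost. In any other
    one, pebble [j.+1] is in [G] at some time and cannot move. *)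
Lemma descent_step j a b p : j < k -> a < N %/ M j -> b < N %/ M j ->
  (forall i, window j a b i -> j <= size (stack i) /\ take j (stack i) = p) ->
  exists a' b' p', [/\ a' < N %/ M j.+1, b' < N %/ M j.+1 &
    forall i, window j.+1 a' b' i ->
      j.+1 < size (stack i) /\ take j.+1 (stack i) = p'].
Proof.
move=> jk aN bN inv.
(* [m] and [m'] are the lengths of nodes of depths [j] and [j.+1]; [n] is the number of children of
   a node. *)
set m' := M j.+1; set m := M j; pose n := c * m' ^ 2.
have m'0 : 0 < m' by apply: level_gt0.
have m0 : 0 < m by apply: level_gt0; apply: ltnW.
have mE : m = n * m' by rewrite /m MS // -/m' /n expnSr mulnA.
have n0 : 0 < n by move: m0; rewrite mE muln_gt0 => /andP[].
have sub_lt x (al : 'I_n) : x < N %/ m -> x * n + al < N %/ m'.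
  rewrite !leq_divRL // mE => h; apply: leq_trans h.
  by rewrite -/m' mulnA leq_mul2r; apply/orP; right; have := ltn_ord al; lia.
have sub_div x y (al : 'I_n) : x %/ m' = y * n + al -> x %/ m = y.
  by move=> e; rewrite mE mulnC divnMA e divnMDl // divn_small ?addn0.
have sub_win (al be : 'I_n) i :
    window j.+1 (a * n + al) (b * n + be) i -> window j a b i.
  case/and3P=> iT /eqP e1 /eqP e2; apply/and3P; split=> //; apply/eqP.
    exact: sub_div e1.
  exact: sub_div e2.
have touch' (al be : 'I_n) : exists i,
    window j.+1 (a * n + al) (b * n + be) i /\
    exists2 u, u \in stack i & u %/ m' = a * n + al.
  by apply: touch => //; apply: sub_lt.
pose W := [set i : 'I_T | window j a b i].
have [i0 i0W] : exists i0, i0 \in W.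
  have [i [iw _]] := touch' (Ordinal n0) (Ordinal n0).
  have iT : i < T by case/and3P: iw.
  by exists (Ordinal iT); rewrite inE; apply: sub_win iw.
case: (arg_minnP (@nat_of_ord T) i0W) => i1 i1W min1.
case: (arg_maxnP (@nat_of_ord T) i0W) => i2 i2W max2.
have WP i : window j a b i <-> i1 <= i <= i2.
  split=> [iw|ii]; last first.
    have w1 : window j a b i1 by move: (i1W : i1 \in W); rewrite inE.
    have w2 : window j a b i2 by move: (i2W : i2 \in W); rewrite inE.
    exact: (convex (ltnW jk) ii).
  have iT : i < T by case/and3P: iw.
  have iW : Ordinal iT \in W by rewrite inE.
  by apply/andP; split; [exact: min1 iW | exact: max2 iW].
have [theta thetaP] := rows jk (ltn_ord i1) (ltn_ord i2) aN.
have cardW : #|W| <= m ^ 2.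
  have -> : m ^ 2 = #|[set: 'I_m * 'I_m]| by rewrite cardsT card_prod card_ord mulnn.
  pose g (i : 'I_T) := (Ordinal (ltn_pmod (pr i).1 m0), Ordinal (ltn_pmod (pr i).2 m0)).
  apply: (card_le_inj_in (g := g)) => // i i'; rewrite !inE.
  move=> /and3P[_ /eqP x1 /eqP y1] /and3P[_ /eqP x2 /eqP y2].
  move=> /(congr1 (fun z : 'I_m * 'I_m => (val z.1, val z.2))) /= [ex ey].
  apply: val_inj; apply: pr_inj => //=.
  rewrite [pr i]surjective_pairing [pr i']surjective_pairing; congr (_, _).
    by rewrite (divn_eq (pr i).1 m) (divn_eq (pr i').1 m) x1 x2 ex.
  by rewrite (divn_eq (pr i).2 m) (divn_eq (pr i').2 m) y1 y2 ey.
pose Vis (z u : 'I_N) := [exists i in W,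
  [&& j < size (stack i), nth 0 (stack i) j == z & val u \in stack i]].
have VisP (z u : 'I_N) : reflect (visits j i1 i2 z u) (Vis z u).
  apply: (iffP existsP) => [[i /andP[]]|[i [ii js jz ui]]].
    by rewrite inE => /WP ii /and3P[js /eqP jz ui]; exists (nat_of_ord i).
  have iw : window j a b i by apply/WP.
  have iT : i < T by case/and3P: iw.
  by exists (Ordinal iT); rewrite inE iw js jz ui eqxx.
(* [Z t] is the part of class [t] outside node [a], and [B t] the set of positions of node [a] that
   it meets in the window. *)
pose Z t := [set z : 'I_N | (z %/ m != a) && (theta z == t)].
pose B t := [set u : 'I_N | (u %/ m == a) && [exists z in Z t, Vis z u]].
have ZB t z u : z \in Z t -> u \in B t -> Vis z u.
  rewrite !inE => /andP[/eqP za /eqP zt] /andP[/eqP ua /existsP[z' /andP[]]].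
  rewrite inE => /andP[/eqP z'a /eqP z't] /VisP v; apply/VisP.
  by apply: thetaP v; rewrite ?zt.
(* The pairs [(z, u)] realized at time [i]: [z] is determined and [u] is one of at most [k] pebbles.
   Double counting then bounds [#|Z t| * #|B t|]. *)
pose F (i : 'I_T) := [set zu : 'I_N * 'I_N |
  (val zu.1 == nth 0 (stack i) j) && (val zu.2 \in stack i)].
have Fk (i : 'I_T) : i \in W -> #|F i| <= k.
  move=> _; apply: leq_trans (cfg_dim (ltn_ord i)).
  rewrite cardE -(size_map (fun zu : 'I_N * 'I_N => val zu.2)).
  apply: uniq_leq_size.
    rewrite map_inj_in_uniq ?enum_uniq // => -[z u] [z' u'].
    rewrite !mem_enum !inE /= => /andP[/eqP ez _] /andP[/eqP ez' _] /val_inj ->.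
    by congr (_, _); apply: val_inj; rewrite /= ez ez'.
  by move=> x /mapP[zu]; rewrite mem_enum inE => /andP[_ h] ->.
have ZBcard t : #|Z t| * #|B t| <= m ^ 2 * k.
  rewrite -cardsX; apply: (@leq_trans (#|W| * k)); last by rewrite leq_mul2r cardW orbT.
  apply: (card_cover_le (F := F)) Fk => -[z u]; rewrite inE => /andP[/= zZ uB].
  have /existsP[i /and4P[iW _ jz ui]] := ZB _ _ _ zZ uB.
  by exists i; rewrite // inE /= eq_sym jz ui.
(* There are at most [K] small classes; with this constant they have together at most n^2 / (4 #|Q|)
   positions. *)
pose C := 4 * #|Q| * K.
(* All positions z of a class Z t meet the same set B t, so #|Z t| * #|B t| is
   bounded by the length of the window: B t is small unless the class is. *)
pose good t := C * #|Z t| <= n ^ 2.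
pose G := [set z : 'I_N | z %/ m == a] :|: \bigcup_(t | good t) Z t.
pose BB := \bigcup_(t | ~~ good t) B t.
have cardG : C * #|G| <= C * m + K * n ^ 2.
  apply: (@leq_trans (C * (m + \sum_(t | good t) #|Z t|))).
    rewrite leq_mul2l; apply/orP; right.
    rewrite (leq_trans (leq_card_setU _ _)) // leq_add ?card_divn_fiber //.
    exact: card_bigcup_le.
  rewrite mulnDr leq_add2l big_distrr /=.
  apply: leq_trans (_ : \sum_(t | good t) n ^ 2 <= _); first exact: leq_sum.
  rewrite sum_nat_const leq_mul2r; apply/orP; right.
  by rewrite -[X in _ <= X]card_ord max_card.
have cardB : #|BB| <= K * (C * (m' ^ 2 * k)).
  apply: leq_trans (card_bigcup_le _ _) _.
  apply: leq_trans (_ : \sum_(t | ~~ good t) C * (m' ^ 2 * k) <= _).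
    apply: leq_sum => t bt; have lt : n ^ 2 < C * #|Z t| by rewrite ltnNge.
    have n2 : 0 < n ^ 2 by rewrite expn_gt0 n0.
    rewrite -(leq_pmul2l n2).
    apply: (@leq_trans (C * #|Z t| * #|B t|)); first by rewrite leq_mul2r (ltnW lt) orbT.
    rewrite -mulnA; apply: (@leq_trans (C * (m ^ 2 * k))); first by rewrite leq_mul2l ZBcard orbT.
    by rewrite mE expnMn; apply: eq_leq; lia.
  rewrite sum_nat_const leq_mul2r; apply/orP; right.
  by rewrite -[X in _ <= X]card_ord max_card.
(* A position lies in one child only, so there are at most [#|BB|] bad children. *)
pose badA := [set al : 'I_n | [exists u in BB, u %/ m' == a * n + al]].
have cardA : #|badA| <= #|BB|.
  pose g (u : 'I_N) : 'I_n := Ordinal (ltn_pmod (u %/ m') n0).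
  apply: leq_trans (leq_imset_card g BB); apply: subset_leq_card.
  apply/subsetP => al; rewrite inE => /existsP[u /andP[uB /eqP e]].
  apply/imsetP; exists u => //; apply: val_inj => /=.
  by rewrite e modnMDl modn_small.
(* The configurations through which pebble j.+1 can enter or leave G. *)
pose Low := [set i : 'I_T | (i \in W) && ((size (stack i) == j) ||
  (size (stack i) == j.+1) && [exists z in G, val z == nth 0 (stack i) j])].
have cardL : #|Low| <= #|Q| * (1 + #|G|).
  (* The lowest [j] entries are [p] throughout the window, so a configuration in [Low] is determined
     by its state and its top pebble in [G], or [None] at height [j]. *)
  pose O := None |: [set Some z | z in G].
  pose g (i : 'I_T) := ((cfg i).1, if size (stack i) == j then None
    else [pick z in G | val z == nth 0 (stack i) j]).
  have -> : #|Q| * (1 + #|G|) = #|setX [set: Q] O|.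
    rewrite cardsX cardsT cardsU1 card_imset; last by move=> ? ? [].
    suff -> : None \notin [set Some z | z in G] by [].
    by apply/imsetP => -[].
  apply: (card_le_inj_in (g := g)) => [i i'|i].
    rewrite /Low in_set [i' \in _]in_set => /andP[iW hi] /andP[i'W hi'].
    move=> [eq ez]; apply: val_inj; apply: cfg_inj => //=.
    rewrite [cfg i]surjective_pairing [cfg i']surjective_pairing eq; congr (_, _).
    have [_ pi] : j <= size (stack i) /\ take j (stack i) = p by apply: inv; move: iW; rewrite inE.
    have [_ pi'] : j <= size (stack i') /\ take j (stack i') = p by apply: inv; move: i'W; rewrite inE.
    have tkS s : size s = j.+1 -> s = rcons (take j s) (nth 0 s j).
      by move=> ss; rewrite -take_nth ?ss // -ss take_size.
    move: hi hi' ez; case: eqP => [ei _|ni /= /andP[/eqP ei /existsP[z /andP[zG zi]]]];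
      case: eqP => [ei' _|ni' /= /andP[/eqP ei' /existsP[z' /andP[zG' zi']]]].
    - by move=> _; rewrite -(take_size (stack i)) -(take_size (stack i')) ei ei' pi pi'.
    - by case: pickP => // /(_ z'); rewrite zG' zi'.
    - by case: pickP => // /(_ z); rewrite zG zi.
    case: pickP => [y /andP[_ /eqP ey]|/(_ z)]; last by rewrite zG zi.
    case: pickP => [y' /andP[_ /eqP ey']|/(_ z')]; last by rewrite zG' zi'.
    by move=> [yy]; rewrite (tkS _ ei) (tkS _ ei') pi pi' -ey -ey' yy.
  rewrite /Low in_set => /andP[_ hi]; rewrite /g in_setX in_setT /= /O in_setU1.
  case: eqP hi => //= _ /andP[_ /existsP[z /andP[zG zi]]].
  case: pickP => [y /andP[yG _]|/(_ z)]; last by rewrite zG zi.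
  exact: imset_f.
pose sub (i : 'I_T) : 'I_n * 'I_n :=
  (Ordinal (ltn_pmod ((pr i).1 %/ m') n0), Ordinal (ltn_pmod ((pr i).2 %/ m') n0)).
(* A bad child rules out [n] subwindows, a configuration in [Low] only one; by the choice of
   [growth_factor] this is at most half of [n ^ 2]. *)
have lowN : #|setX badA [set: 'I_n] :|: [set sub i | i in Low]| < n ^ 2.
  apply: leq_ltn_trans (leq_card_setU _ _) _.
  rewrite cardsX cardsT card_ord.
  apply: leq_ltn_trans (_ : K * (C * (m' ^ 2 * k)) * n + #|Q| * (1 + #|G|) < _).
    rewrite leq_add ?leq_mul2r ?(leq_trans cardA) ?orbT //.
    exact: leq_trans (leq_imset_card _ _) cardL.
  have Q0 : 0 < #|Q| by apply/card_gt0P; exists (cfg 0).1.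
  have g1 : 4 * (#|Q| * #|G|) <= 4 * (#|Q| * m) + n ^ 2.
    rewrite -(leq_pmul2l K_gt0); apply: leq_trans (_ : C * #|G| <= _).
      by apply: eq_leq; rewrite /C; lia.
    by apply: leq_trans cardG _; apply: eq_leq; rewrite /C; lia.
  have g2 : 4 * (K * (C * (m' ^ 2 * k)) * n) + 8 * #|Q| * m' ^ 2 * n = n ^ 2.
    rewrite -[n ^ 2]mulnn {3}/n /growth_factor /C.
    by rewrite mulnDl mulnDl; lia.
  have g3 : 4 * (#|Q| * m) + 4 * #|Q| <= 8 * #|Q| * m' ^ 2 * n.
    rewrite mE.
    have h1 : m' <= m' ^ 2 by rewrite -mulnn leq_pmulr.
    have h2 : #|Q| * (n * m') <= #|Q| * (n * m' ^ 2) by rewrite !leq_mul2l h1 !orbT.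
    have h3 : #|Q| <= #|Q| * (n * m' ^ 2).
      by rewrite leq_pmulr // muln_gt0 n0 expn_gt0 m'0.
    lia.
  have n2 : 0 < n ^ 2 by rewrite expn_gt0 n0.
  lia.
have [[al be]] : exists x, x \notin setX badA [set: 'I_n] :|: [set sub i | i in Low].
  apply/existsP; rewrite -negb_forall; apply/negP => /forallP all.
  move: lowN; rewrite ltnNge => /negP; apply.
  have -> : n ^ 2 = #|[set: 'I_n * 'I_n]| by rewrite cardsT card_prod card_ord mulnn.
  by apply: subset_leq_card; apply/subsetP => x _; apply: all.
rewrite in_setU in_setX in_setT andbT negb_or => /andP[alA notlow].
set a' := a * n + al; set b' := b * n + be.
have {notlow} notLow i : window j.+1 a' b' i -> size (stack i) <> j /\
    (size (stack i) = j.+1 -> forall z : 'I_N, z \in G -> val z <> nth 0 (stack i) j).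
  move=> iw; have iT : i < T by case/and3P: iw.
  have : Ordinal iT \notin Low.
    apply: contra notlow => iL; apply/imsetP; exists (Ordinal iT) => //.
    case/and3P: iw => _ /eqP e1 /eqP e2; rewrite /sub; congr (_, _); apply: val_inj => /=.
      by rewrite e1 modnMDl modn_small.
    by rewrite e2 modnMDl modn_small.
  rewrite in_set inE (sub_win _ _ _ iw) /= negb_or => /andP[/eqP ne hn]; split=> // sj z zG ez.
  by move/negP: hn; apply; rewrite sj eqxx; apply/existsP; exists z; rewrite zG ez eqxx.
have inv' i : window j.+1 a' b' i -> j < size (stack i) /\ take j (stack i) = p.
  move=> iw; have [js tk] := inv i (sub_win _ _ _ iw); split=> //.
  by have [ne _] := notLow _ iw; rewrite ltn_neqAle js andbT; apply/eqP => e; apply: ne.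
have [it [itw [u us ua]]] := touch' al be.
have itT : it < T by case/and3P: itw.
have uN : u < N by apply: (allP (cfg_pos itT)).
have [js tks] := inv' _ itw.
have zN : nth 0 (stack it) j < N by apply: (allP (cfg_pos itT)); apply: mem_nth.
pose z := Ordinal zN.
(* Otherwise [z] is in a large class and [u] in [BB], which makes the child [al] bad. *)
have zG : z \in G.
  apply/negPn/negP; rewrite in_setU inE negb_or => /andP[za zU].
  have zZ : z \in Z (theta z) by rewrite inE za eqxx.
  have bad : ~~ good (theta z).
    by apply: contra zU => gz; apply/bigcupP; exists (theta z).
  move/negP: alA; apply; rewrite inE; apply/existsP; exists (Ordinal uN).
  rewrite ua eqxx andbT; apply/bigcupP; exists (theta z) => //.
  rewrite inE (sub_div _ _ _ ua) eqxx /=; apply/existsP; exists z; rewrite zZ /=.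
  by apply/VisP; exists it; split=> //; apply/WP; apply: sub_win itw.
pose P i := nth 0 (stack i) j = z.
have W'P i : window j.+1 a' b' i -> P i -> j.+1 < size (stack i).
  move=> iw Pi; have [js' _] := inv' _ iw; have [_ h] := notLow _ iw.
  rewrite ltn_neqAle js' andbT; apply/eqP => e.
  by apply: (h (esym e) z zG); rewrite Pi.
(* Pebble [j.+1] can change only through a stack of height at most [j.+1]; with this pebble at [z]
   in [G], such a stack would be in [Low]. *)
have allP i : window j.+1 a' b' i -> P i.
  move=> iw.
  have win' x : minn it i <= x <= maxn it i -> window j.+1 a' b' x.
    case: (leqP it i) => le xx; first exact: (convex jk xx itw iw).
    exact: (convex jk xx iw itw).
  apply: (@interval_propagate P (minn it i) (maxn it i) it); [lia|lia|by []|].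
  move=> x x1 x2.
  have w1 : window j.+1 a' b' x by apply: win'; lia.
  have w2 : window j.+1 a' b' x.+1 by apply: win'; lia.
  have xT : x.+1 < T by case/and3P: w2.
  have st := cfg_stack xT.
  have [s1 _] := inv' _ w1; have [s2 _] := inv' _ w2.
  split=> Px; rewrite /P -Px.
    by apply: stack_ok_nth st _ _ => //; apply: W'P.
  by apply: stack_ok_nth (stack_ok_sym st) _ _ => //; apply: W'P.
exists a', b', (rcons p z); split; [exact: sub_lt|exact: sub_lt|].
move=> i iw; have [js' tk] := inv' _ iw; split; first exact/W'P/allP.
by rewrite (take_nth 0) // tk allP.
Qed.

(** Starting from the full run, [k] steps lead to a window in which all stacks are higher than [k],
    and [touch] provides a configuration there. *)
Lemma descent : 0 < k -> False.
Proof.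
move=> k0.
have N0 : 0 < N by rewrite -M0 level_gt0.
have base : exists a b p, [/\ a < N %/ M 0, b < N %/ M 0 &
    forall i, window 0 a b i -> 0 <= size (stack i) /\ take 0 (stack i) = p].
  by exists 0, 0, [::]; rewrite M0 divnn N0; split=> // i _; rewrite take0.
have H j : j < k -> exists a b p, [/\ a < N %/ M j.+1, b < N %/ M j.+1 &
    forall i, window j.+1 a b i -> j.+1 < size (stack i) /\ take j.+1 (stack i) = p].
  elim: j => [|j IH] jk.
    by case: base => a [b [p [aN bN inv]]]; apply: descent_step inv.
  case: (IH (ltnW jk)) => a [b [p [aN bN inv]]].
  by apply: (@descent_step j.+1 a b p) => // i /inv[/ltnW].
have [] := H k.-1; first by lia.
rewrite prednK // => a [b [p [aN bN inv]]].
have [|i [iw _]] := @touch k a b _ aN bN; first by rewrite k0 leqnn.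
have iT : i < T by case/and3P: iw.
by have [] := inv i iw; rewrite ltnNge cfg_dim.
Qed.

End Descent.

(** * Classes of pebble values *)

Section Runs.
Variables (Sigma Gamma : eqType) (I : interp Sigma Gamma).
Local Notation conf := (Defs.comp I * seq nat)%type.
Implicit Types (w : seq Sigma) (q : Defs.comp I).

Definition run_of (f : seq Sigma -> seq Gamma) w (s : seq conf) : Prop :=
  [/\ uniq s,
      (forall e, e \in s <-> out_elem w e),
      size s = size (f w),
      (forall e e', e \in s -> e' \in s ->
         (out_le w e e' <-> index e s <= index e' s)) &
      (forall e c, e \in s ->
         (out_lab w c e <-> nth c (f w) (index e s) = c))].

(** Layout of the variables: the tuple of state [q], then z and u at [d] and [d.+1], then the tuples
    of the two configurations that delimit the time interval. *)
Definition meets_body q q1 q2 j i w l : Prop :=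
  let sel r := [seq nth 0 l x | x <- r] in
  let d := dim q in
  let self := iota 0 d in
  (holds w (univ_f q) (sel self) /\
   holds w (le_f q1 q) (sel (iota d.+2 (dim q1) ++ self))) /\
  (holds w (le_f q q2) (sel (self ++ iota (d.+2 + dim q1) (dim q2))) /\
   (holds w (MEq _ d j) l /\ holds w (MEq _ d.+1 i) l)).

Definition meets q q1 q2 j i w l : Prop :=
  exists c, [/\ size c = dim q, all (fun p => p < size w) c &
    meets_body q q1 q2 j i w (c ++ l)].

Lemma definable_meets q q1 q2 j i :
  definable (dim q1 + dim q2).+2 (meets q q1 q2 j i).
Proof.
have sel n phi r :
    definable n (fun w l => holds w phi [seq nth 0 l x | x <- r]).
  exact: (@definable_select _ n r (fun w l => holds w phi l) (definable_holds _ _)).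
apply: definable_exists_tuple.
apply: definable_and; apply: definable_and; [exact: sel|exact: sel|exact: sel|].
by apply: definable_and; apply: definable_holds.
Qed.

Lemma sel_iota (l1 l2 l3 : seq nat) :
  [seq nth 0 (l1 ++ l2 ++ l3) x | x <- iota (size l1) (size l2)] = l2.
Proof.
apply: (@eq_from_nth _ 0); first by rewrite size_map size_iota.
move=> i; rewrite size_map size_iota => il.
by rewrite (nth_map 0) ?size_iota // nth_iota // nth_cat ltnNge leq_addr /= addKn
  nth_cat il.
Qed.

Lemma meetsE q q1 q2 j i w z u c1 c2 :
  size c1 = dim q1 -> size c2 = dim q2 -> j < dim q -> i < dim q ->
  meets q q1 q2 j i w [:: z, u & c1 ++ c2] <->
  exists c, [/\ out_elem w (q, c), out_le w (q1, c1) (q, c),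
    out_le w (q, c) (q2, c2), nth 0 c j = z & nth 0 c i = u].
Proof.
move=> s1 s2 jd id.
suff H c : size c = dim q -> meets_body q q1 q2 j i w (c ++ [:: z, u & c1 ++ c2]) <->
    [/\ holds w (univ_f q) c, out_le w (q1, c1) (q, c),
    out_le w (q, c) (q2, c2), nth 0 c j = z & nth 0 c i = u].
  split=> [[c [sc cw /(H _ sc) [? ? ? ? ?]]]|[c [[/= sc [cw ?]] ? ? ? ?]]].
    by exists c.
  by exists c; split=> //; apply/H.
move=> sc; rewrite /meets_body !map_cat.
have e0 : [seq nth 0 (c ++ [:: z, u & c1 ++ c2]) x | x <- iota 0 (dim q)] = c.
  by rewrite -sc; apply: (sel_iota [::]).
have e1 : [seq nth 0 (c ++ [:: z, u & c1 ++ c2]) x | x <- iota (dim q).+2 (dim q1)] = c1.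
  have := sel_iota (c ++ [:: z; u]) c1 c2.
  by rewrite size_cat sc s1 addn2 -!catA.
have e2 : [seq nth 0 (c ++ [:: z, u & c1 ++ c2]) x |
    x <- iota ((dim q).+2 + dim q1) (dim q2)] = c2.
  have := sel_iota (c ++ [:: z, u & c1]) c2 [::].
  by rewrite size_cat /= sc s1 s2 cats0 -catA !addnS addSn.
rewrite e0 e1 e2 /holds /= !nth_cat sc jd id ltnn ltnNge leqnSn subnn subSnn /=.
split=> [[[? ?] [? [<- <-]]]|[? ? ? <- <-]]; by [].
Qed.

(** [K] must not depend on the word, because the tree is built from [K]. One map [h] serves all of
    the finitely many states and stack entries; the class of z consists of the values of [h] on the
    two sides of the factor, with z marked. *)
Lemma rows_bound k : exists2 K, 0 < K &
  forall f w s e0, run_of f w s -> 0 < size w -> dim_le I k ->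
  forall j i1 i2 o m, j < k -> i1 < size s -> i2 < size s ->
    0 < m -> o + m <= size w ->
  exists theta : nat -> 'I_K, forall z z', z < size w -> z' < size w ->
    ~~ (o <= z < o + m) -> ~~ (o <= z' < o + m) -> theta z = theta z' ->
  forall u, o <= u < o + m ->
    visits (nth e0 s) j i1 i2 z u -> visits (nth e0 s) j i1 i2 z' u.
Proof.
pose J := (Defs.comp I * Defs.comp I * Defs.comp I * 'I_k * 'I_k)%type.
have [T [h hh]] := @definable_family Sigma J
  (fun x => (dim x.1.1.1.2 + dim x.1.1.2).+2)
  (fun x => meets x.1.1.1.1 x.1.1.1.2 x.1.1.2 x.1.2 x.2)
  (fun x => @definable_meets _ _ _ _ _).
exists #|{: T * T}|; first by apply/card_gt0P; exists (h [::], h [::]).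
move=> f w s e0 [us ms ss ls _] w0 dk j i1 i2 o m jk i1s i2s m0 om.
have eb i : i < size s -> out_elem w (nth e0 s i) by move=> ?; apply/ms/mem_nth.
case E1 : (nth e0 s i1) (eb _ i1s) => [q1 c1] [/= sc1 [wc1 _]].
case E2 : (nth e0 s i2) (eb _ i2s) => [q2 c2] [/= sc2 [wc2 _]].
pose L := take o w; pose U := take m (drop o w); pose r := drop m (drop o w).
have wE : w = L ++ U ++ r by rewrite /U /r cat_take_drop cat_take_drop.
have sL : size L = o by rewrite size_takel //; lia.
have sU : size U = m by rewrite size_takel // size_drop; lia.
pose l := c1 ++ c2.
(* The position [o] of the factor stands for the unknown [u], so the class depends on [z] alone. *)
exists (fun z => enum_rank (h (enl 0 L [:: z, o & l]), h (enl (o + m) r [:: z, o & l]))).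
move=> z z' zw z'w zo z'o /enum_rank_inj[hL hr] u uo [i [ii js jz ui]].
have is_ : i < size s by lia.
case E : (nth e0 s i) (eb _ is_) js jz ui => [q c] /= oc js jz ui.
have [/= sc [wc _]] := oc.
have jd : j < dim q by rewrite -sc.
have xd : index u c < dim q by rewrite -sc index_mem.
have xk : index u c < k by apply: leq_trans xd (dk q).
have [P [hP PR]] := hh (q, q1, q2, Ordinal jk, Ordinal xk).
have idx x : x < size s -> index (nth e0 s x) s = x by move=> ?; rewrite index_uniq.
have m1 : meets q q1 q2 j (index u c) w [:: z, u & l].
  apply/meetsE => //; exists c; split; rewrite ?nth_index //.
    by apply/ls; rewrite -?E -?E1 ?mem_nth // !idx //; lia.
  by apply/ls; rewrite -?E -?E2 ?mem_nth // !idx //; lia.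
have : meets q q1 q2 j (index u c) w [:: z', u & l].
  move: m1; rewrite wE.
  apply: (move_outer_mark hP PR (u0 := o)); rewrite -?wE ?sL ?sU //.
  - by rewrite size_cat sc1 sc2.
  - by rewrite all_cat wc1.
  - by rewrite leqnn; lia.
case/meetsE => // c' [oc' le1 le2 jz' xu].
have cs : (q, c') \in s by apply/ms.
have [/= sc' _] := oc'.
exists (index (q, c') s); rewrite nth_index //=; split; rewrite ?sc' //.
  apply/andP; split; [rewrite -(idx _ i1s) E1 | rewrite -[X in _ <= X](idx _ i2s) E2].
    by apply/ls => //; rewrite -E1 mem_nth.
  by apply/ls => //; rewrite -E2 mem_nth.
by rewrite -xu mem_nth // sc'.
Qed.

End Runs.

(** * Leaves have to be touched *)

Lemma sorted_index (A : eqType) (r : seq A) : uniq r ->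
  sorted (fun x y => index x r < index y r) r.
Proof.
move=> ur; rewrite -(@sorted_map _ _ (fun x => index x r) ltn).
suff -> : [seq index x r | x <- r] = iota 0 (size r) by apply: iota_ltn_sorted.
case: r ur => // x0 r ur; apply: (@eq_from_nth _ 0); rewrite ?size_map ?size_iota //.
by move=> i ir; rewrite (nth_map x0) // index_uniq // nth_iota.
Qed.

Lemma eq_sorted_filter (A : eqType) (r r' : seq A) (p : pred A) :
  uniq r -> uniq r' -> {in p, r =i r'} ->
  {in [pred x | p x & x \in r] &, forall x y,
    (index x r <= index y r) = (index x r' <= index y r')} ->
  filter p r = filter p r'.
Proof.
move=> ur ur' rr' H; set lt := fun x y => index x r' < index y r'.
have tr : transitive lt by move=> y x z; apply: ltn_trans.
apply: (@irr_sorted_eq _ lt) => // [x|||x].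
- by rewrite /lt ltnn.
- have lt_tr : transitive (fun x y => index x r < index y r).
    by move=> y x z; apply: ltn_trans.
  have := sorted_filter lt_tr p (sorted_index ur).
  apply: (@sub_in_sorted _ [pred x | p x & x \in r]); last first.
    by apply/allP => x; rewrite mem_filter.
  by move=> x y xp yp; rewrite /lt !ltnNge H.
- exact: sorted_filter (sorted_index ur').
- rewrite !mem_filter; have := rr' x; rewrite [x \in p]/(_ \in _).
  by case: (boolP (p x)) => //= px; apply.
Qed.

Section Untouched.
Variables (Sigma : finType) (I : interp Sigma Sigma).
Local Notation conf := (Defs.comp I * seq nat)%type.
Implicit Types (q : Defs.comp I) (e : conf) (w L r v : seq Sigma).

Definition respects (T : finType) (h : seq (mletter Sigma) -> T)
    (phi : mso Sigma) : Prop :=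
  forall L r v v' l, 0 < size L -> size v = size v' ->
    all (fun p => p < size (L ++ v ++ r)) l -> avoids (size L) (size v) l ->
    h (bare v) = h (bare v') ->
    holds (L ++ v ++ r) phi l -> holds (L ++ v' ++ r) phi l.

Lemma respects_family (J : finType) (phi : J -> mso Sigma) :
  exists (T : finType) (h : seq (mletter Sigma) -> T), forall j, respects h (phi j).
Proof.
have /choice [P hP] := fun j => holds_recognizable (phi j).
have [T [h hh]] := recognizable_family (fun j => (hP j).1).
exists T, h => j L r v v' l L0 vv' lw lv hv.
exact: (replace_factor (hh j) ((hP j).2 (size l))).
Qed.

Definition respects_interp (T : finType) (h : seq (mletter Sigma) -> T) : Prop :=
  [/\ forall q, respects h (univ_f q),
      forall q q', respects h (le_f q q') &
      forall a q, respects h (lab_f a q)].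

Lemma respects_interp_ex :
  exists (T : finType) (h : seq (mletter Sigma) -> T), respects_interp h.
Proof.
pose J : finType :=
  (Defs.comp I + (Defs.comp I * Defs.comp I) + (Sigma * Defs.comp I))%type.
pose phi (j : J) := match j with
  | inl (inl q) => univ_f q
  | inl (inr x) => le_f x.1 x.2
  | inr x => lab_f x.1 x.2
  end.
have [T [h hh]] := respects_family phi.
exists T, h; split.
- by move=> q; apply: (hh (inl (inl q))).
- by move=> q q'; apply: (hh (inl (inr (q, q')))).
- by move=> a q; apply: (hh (inr (a, q))).
Qed.

(* The configurations that do not touch the factor v form the same sequence,
   with the same labels, for all v of one type; this sequence has few factors. *)
Lemma few_untouched (T : finType) (h : seq (mletter Sigma) -> T)
    (f : seq Sigma -> seq Sigma) (L r : seq Sigma) s (V : seq (seq Sigma))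
    (run : seq Sigma -> seq conf) B (untouched := fun e => avoids (size L) s e.2)
    (w := fun v => L ++ v ++ r) :
  respects_interp h -> 0 < size L -> 0 < s -> uniq V ->
  {in V, forall v, size v = s} -> {in V &, forall v v', h (bare v) = h (bare v')} ->
  {in V, forall v, run_of f (w v) (run v)} ->
  {in V, forall v, size (run v) <= B} ->
  {in V, forall v, exists i, all untouched (take s (drop i (run v))) /\
    take s (drop i (f (w v))) = v} ->
  size V <= B.+1.
Proof.
move=> [hu hl hb] L0 s0 uV sV hV rV BV bad.
case: (V =P [::]) => [-> //|/eqP V0].
have [v0 v0V] : exists v0, v0 \in V by case: (V) V0 => // v V' _; exists v; rewrite mem_head.
have [d _] : exists d : Sigma, true.
  have := sV _ v0V; case: (v0) => [e|d ? _]; last by exists d.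
  by move: s0; rewrite -e.
have sw v v' : v \in V -> v' \in V -> size (w v) = size (w v').
  by move=> vV v'V; rewrite /w !size_cat (sV v) ?(sV v').
have posr v e : v \in V -> e \in run v -> all (fun p => p < size (w v)) e.2.
  by move=> vV; have [_ m _ _ _] := rV _ vV; case/m => _ [].
have swap phi v v' l : respects h phi -> v \in V -> v' \in V ->
    all (fun p => p < size (w v)) l -> avoids (size L) s l ->
    holds (w v) phi l -> holds (w v') phi l.
  move=> hphi vV v'V lw ul; apply: (hphi L r v v' l L0 _ lw); last exact: hV.
    by rewrite (sV v) ?(sV v').
  by rewrite (sV v).
have mem_run v v' : v \in V -> v' \in V -> forall e, untouched e ->
    e \in run v -> e \in run v'.
  move=> vV v'V e ue ev; have [_ m _ _ _] := rV _ vV; have [_ m' _ _ _] := rV _ v'V.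
  have [se [pe he]] := (m e).1 ev; apply/m'.
  split=> //; split; first by rewrite (sw _ v).
  by apply: (swap _ _ _ _ (hu _) vV v'V) he.
have le_run v v' : v \in V -> v' \in V -> forall e e', untouched e -> untouched e' ->
    e \in run v -> e' \in run v ->
    index e (run v) <= index e' (run v) -> index e (run v') <= index e' (run v').
  move=> vV v'V e e' ue ue' ev e'v.
  have [_ _ _ o _] := rV _ vV; have [_ _ _ o' _] := rV _ v'V.
  move=> /(o _ _ ev e'v) le; apply/o'; [exact: mem_run ev|exact: mem_run e'v|].
  apply: (swap _ _ _ _ (hl _ _) vV v'V) le; first by rewrite all_cat !posr.
  by rewrite /avoids all_cat; apply/andP.
pose lab v e := nth d (f (w v)) (index e (run v)).
have lab_run v v' : v \in V -> v' \in V -> forall e, untouched e -> e \in run v ->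
    lab v e = lab v' e.
  move=> vV v'V e ue ev; have ev' := mem_run _ _ vV v'V _ ue ev.
  have [_ _ sz _ b] := rV _ vV; have [_ _ sz' _ b'] := rV _ v'V.
  have /(b _ _ ev) le : nth (lab v e) (f (w v)) (index e (run v)) = lab v e.
    by apply: set_nth_default; rewrite -sz index_mem.
  have /(b' _ _ ev') <- : out_lab (w v') (lab v e) e.
    by apply: (swap _ _ _ _ (hb _ _) vV v'V) le; first exact: posr.
  by apply: set_nth_default; rewrite -sz' index_mem.
pose S := filter untouched (run v0).
have SE v : v \in V -> filter untouched (run v) = S.
  move=> vV; have [u _ _ _ _] := rV _ vV; have [u0 _ _ _ _] := rV _ v0V.
  apply: eq_sorted_filter => // [e ue|e e' /andP[/= ue ev] /andP[/= ue' ev']].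
    by apply/idP/idP; [exact: (mem_run v v0) | exact: (mem_run v0 v)].
  have ev0 := mem_run _ _ vV v0V _ ue ev; have ev0' := mem_run _ _ vV v0V _ ue' ev'.
  by apply/idP/idP; [exact: (le_run v v0) | exact: (le_run v0 v)].
pose LS := map (lab v0) S.
have sLS : size LS <= B.
  rewrite size_map; apply: leq_trans (BV _ v0V).
  by rewrite size_filter count_size.
(* The [s] untouched outputs that spell [v] are a factor of [LS], and at most [B.+1] starting points
   are possible. *)
suff sub : {subset V <= [seq take s (drop o LS) | o <- iota 0 (size LS).+1]}.
  apply: leq_trans (uniq_leq_size uV sub) _.
  by rewrite size_map size_iota.
move=> v vV; have [i [ui fi]] := bad _ vV.
have [u _ sz _ _] := rV _ vV.
have fE : f (w v) = map (lab v) (run v).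
  apply: (@eq_from_nth _ d); rewrite ?size_map //.
  move=> j; rewrite -sz => jr.
  have [e0 _] : exists e0 : conf, true by case: (run v) jr => // e0; exists e0.
  by rewrite (nth_map e0) // /lab index_uniq.
pose A := take i (run v); pose C := take s (drop i (run v)).
pose D := drop s (drop i (run v)).
have rE : run v = A ++ C ++ D by rewrite /C /D cat_take_drop cat_take_drop.
have CE : filter untouched C = C by apply/all_filterP.
have sC : size C = s.
  by rewrite -(size_map (lab v)) /C map_take map_drop -fE fi sV.
apply/mapP; exists (size (filter untouched A)).
  rewrite mem_iota ltnS /= /LS size_map -(SE _ vV) !size_filter rE count_cat.
  exact: leq_addr.
rewrite /LS -map_drop -map_take -(SE _ vV) rE !filter_cat drop_size_cat // CE.
rewrite take_size_cat // -[LHS]fi fE -map_drop -map_take -/C.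
apply/eq_in_map => e eC; apply: lab_run => //.
  by apply: (allP ui).
by rewrite rE !mem_cat eC orbT.
Qed.

End Untouched.

(** * Counting arguments for the choice of leaf words *)

Definition update (n : nat) (D : Type) (l : {ffun 'I_n -> D}) t v : {ffun 'I_n -> D} :=
  [ffun u => if u == t then v else l u].

(** Union bound: at each of the [n] coordinates at most a fraction [B / D] of all labellings is
    bad. *)
Lemma exists_good_labelling n D B (bad : 'I_n -> {ffun 'I_n -> 'I_D} -> bool) :
  (forall t l, #|[set v | bad t (update l t v)]| <= B) -> n * B < D ->
  exists l, forall t, ~~ bad t l.
Proof.
move=> badB nBD; pose Bad t := [set l | bad t l].
have cB t : #|Bad t| * D <= D ^ n * B.
  pose A := [set x : {ffun 'I_n -> 'I_D} * 'I_D | bad t (update x.1 t x.2)].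
  (* Overwriting coordinate [t] of a bad labelling while recording the old value is reversible, and
     it lands in [A]. *)
  apply: (@leq_trans #|A|).
    rewrite -[X in _ * X]card_ord -cardsT -cardsX.
    apply: (card_le_inj_in (g := fun x => (update x.1 t x.2, x.1 t))).
      move=> [l u] [l' u'] _ _ /= [e1 e2]; have e u0 : update l t u u0 = update l' t u' u0 by rewrite e1.
      have eu : u = u' by have := e t; rewrite /= !ffunE eqxx.
      congr (_, _) => //; apply/ffunP => u0.
      by have := e u0; rewrite /= !ffunE; case: eqP => [->|].
    move=> [l u]; rewrite !inE /= andbT.
    suff -> : update (update l t u) t (l t) = l by [].
    by apply/ffunP => u0; rewrite !ffunE; case: eqP => [->|].
  have -> : D ^ n = #|[set: {ffun 'I_n -> 'I_D}]| by rewrite cardsT card_ffun !card_ord.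
  pose F (l : {ffun 'I_n -> 'I_D}) := [set (l, v) | v in [set v | bad t (update l t v)]].
  apply: (card_cover_le (F := F)) => [[l v]|l _].
    rewrite inE /= => lv; exists l; rewrite ?inE //.
    by apply/imsetP; exists v; rewrite ?inE.
  exact: leq_trans (leq_imset_card _ _) (badB t l).
have D0 : 0 < D by lia.
pose U := \bigcup_(t in [set: 'I_n]) Bad t.
have cU : #|U| < D ^ n.
  rewrite -(ltn_pmul2r D0); apply: (@leq_ltn_trans (n * (D ^ n * B))).
    rewrite (leq_trans (leq_mul (card_bigcup_le _ _) (leqnn D))) // big_distrl /=.
    apply: leq_trans (_ : \sum_(t in [set: 'I_n]) D ^ n * B <= _); first exact: leq_sum.
    by rewrite sum_nat_const cardsT card_ord.
  by rewrite mulnCA ltn_pmul2l // expn_gt0 D0.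
have /existsP[l lU] : [exists l, l \notin U].
  rewrite -negb_forall; apply/negP => /forallP all.
  move: cU; rewrite ltnNge => /negP; apply.
  have -> : D ^ n = #|[set: {ffun 'I_n -> 'I_D}]| by rewrite cardsT card_ffun !card_ord.
  by apply: subset_leq_card; apply/subsetP => x _; apply: all.
exists l => t; apply: contra lU => bt; apply/bigcupP; exists t; rewrite ?inE //.
Qed.

Lemma exp_beats_poly a e : exists2 s, 0 < s & a * s.+1 ^ e < 2 ^ s.
Proof.
(* [s.+1] will be [2 ^ r], which turns its powers into powers of 2; [r] is even so that [2 ^ r] is a
   square, at least [q.+1 * q.+1]. *)
pose q := (a + 2 * e).+2; pose r := 2 * q.
have hr : a + e * r < (2 ^ r).-1.
  have h : q.+1 * q.+1 <= 2 ^ r.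
    by rewrite /r mulnC expnM -mulnn leq_mul // ltn_expl.
  by move: h; rewrite /r /q; lia.
have p0 : 0 < 2 ^ r by rewrite expn_gt0.
exists (2 ^ r).-1; first by lia.
rewrite prednK // -expnM mulnC [r * e]mulnC.
apply: leq_ltn_trans (_ : 2 ^ (a + e * r) < _); last by rewrite ltn_exp2l.
by rewrite expnD mulnC leq_mul2r (ltnW (ltn_expl _ _)) ?orbT.
Qed.

(** * The lower bound *)

(** Makes the tree length polynomial in [s.+1], of a degree depending on the depth only, whereas
    there are [2 ^ s] leaf words. *)
Lemma iter_cube_le c m i : 0 < c -> 0 < m ->
  iter i (fun x => c * x ^ 3) m <= (c * m) ^ 4 ^ i.
Proof.
move=> c0 m0; elim: i => [|i IH]; first by rewrite expn0 expn1 leq_pmull.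
rewrite iterS; apply: (@leq_trans (c * m * ((c * m) ^ 4 ^ i) ^ 3)).
  by apply: leq_mul; [apply: leq_pmulr | rewrite leq_exp2r].
have p0 : 0 < 4 ^ i by rewrite expn_gt0.
rewrite -expnM -expnS leq_pexp2l ?muln_gt0 ?c0 // expnS; lia.
Qed.

Lemma pigeonhole_fiber (A T : finType) (g : A -> T) D :
  #|T| * D < #|A| -> exists2 pv : 'I_D -> A, injective pv &
    forall i j, g (pv i) = g (pv j).
Proof.
move=> lt; have [t Dt] : exists t, D <= #|[set x | g x == t]|.
  apply/existsP; rewrite -[[exists _, _]]negbK negb_exists; apply/negP => /forallP small.
  move: lt; rewrite ltnNge => /negP; apply; rewrite -cardsT.
  rewrite -[in X in _ <= X]cardsT.
  apply: (card_cover_le (F := fun t => [set x | g x == t])) => [x _|t _].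
    by exists (g x); rewrite !inE.
  by apply: ltnW; rewrite ltnNge.
have ub (i : 'I_D) : i < #|[set x | g x == t]| by apply: leq_trans Dt.
exists (fun i => enum_val (Ordinal (ub i))) => [i j /enum_val_inj /(congr1 val) /= ij|i j].
  exact: val_inj.
by have := enum_valP (Ordinal (ub i)); have := enum_valP (Ordinal (ub j));
  rewrite !inE => /eqP -> /eqP ->.
Qed.

Section LowerBound.
Variable k' : nat.
Local Notation k := k'.+1.
Variable I : interp (letter k) (letter k).
Hypothesis I_pebble : pebble_transducer I.
Hypothesis I_dim : dim_le I k.
Local Notation conf := (Defs.comp I * seq nat)%type.
Local Notation f := (@nested_squaring k).
Variable run : seq (letter k) -> seq conf.
Hypothesis runP : forall w, run_of f w (run w).

Lemma run_consecutive w i e0 : i.+1 < size (run w) ->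
  consecutive w (nth e0 (run w) i) (nth e0 (run w) i.+1).
Proof.
move=> ir; have [u m sz o _] := runP w; have ir' := ltnW ir.
have mi : nth e0 (run w) i \in run w by apply: mem_nth.
have mi' : nth e0 (run w) i.+1 \in run w by apply: mem_nth.
split; [exact/m|exact/m| |by apply/o; rewrite ?index_uniq|].
  by move/eqP; rewrite nth_uniq // => /eqP; lia.
move=> e /m er ne ne' [/(o _ _ mi er) le /(o _ _ er mi') le'].
rewrite !index_uniq // in le le'.
have : index e (run w) = i \/ index e (run w) = i.+1 by lia.
by case=> ei; [apply: ne | apply: ne']; rewrite -ei nth_index.
Qed.

Section Input.
Variables (s K : nat) (M : nat -> nat) (e0 : conf) (ids : nat -> seq bool).
Local Notation N := (M 0).
Hypothesis K_gt0 : 0 < K.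
Hypothesis Mk : M k = s.+1.
Hypothesis MS : forall j, j < k -> M j = growth_factor (Defs.comp I) k K * M j.+1 ^ 3.
Hypothesis M_gt0 : forall j, j <= k -> 0 < M j.
Local Notation w := (tree_word k' s M ids).
Hypothesis w_rows : forall j i1 i2 o m, j < k -> i1 < size (run w) ->
    i2 < size (run w) -> 0 < m -> o + m <= size w ->
  exists theta : nat -> 'I_K, forall z z', z < size w -> z' < size w ->
    ~~ (o <= z < o + m) -> ~~ (o <= z' < o + m) -> theta z = theta z' ->
  forall u, o <= u < o + m ->
    visits (nth e0 (run w)) j i1 i2 z u -> visits (nth e0 (run w)) j i1 i2 z' u.
Hypothesis w_touch : forall t i, t < N %/ s.+1 ->
  all (fun e : conf => avoids (t * s.+1).+1 s e.2) (take s (drop i (run w))) ->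
  take s (drop i (f w)) <> map inr (ids t).
Hypothesis size_ids : forall t, t < N %/ s.+1 -> size (ids t) = s.

Lemma M_dvd i j : i <= j -> j <= k -> M j %| M i.
Proof.
move=> ij; rewrite -(subnKC ij); elim: (j - i) => [|d IH]; first by rewrite addn0.
rewrite addnS => h; apply: dvdn_trans (IH (ltnW h)).
by rewrite (MS h) expnS mulnCA dvdn_mulr.
Qed.

Lemma divn_eq_interval x m a : 0 < m -> (x %/ m == a) = (a * m <= x < a * m + m).
Proof.
by move=> m0; rewrite eqn_leq leq_divRL // -ltnS ltn_divLR // mulSnr andbC.
Qed.

Lemma input_contradiction : False.
Proof.
have [u m sz o lb] := runP w.
have szN : size (run w) = N ^ 2 by rewrite sz size_squaring size_tree_word.
pose pr i := nth (0, 0) (pairs w) i.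
have prp i : i < N ^ 2 -> pr i \in pairs w.
  by move=> iT; apply: mem_nth; rewrite size_pairs size_tree_word.
have ipr i : i < N ^ 2 -> index (pr i) (pairs w) = i.
  by move=> iT; rewrite index_uniq ?pairs_uniq // size_pairs size_tree_word.
apply: (@descent (Defs.comp I) k N K M (nth e0 (run w)) pr) => //.
- exact: M_gt0.
- move=> i i' iT i'T /eqP; rewrite nth_uniq ?szN // => /eqP //.
- move=> i iT; have /m [_ [+ _]] : nth e0 (run w) i \in run w by rewrite mem_nth ?szN.
  by rewrite size_tree_word.
- move=> i iT; have /m [-> _] : nth e0 (run w) i \in run w by rewrite mem_nth ?szN.
  exact: I_dim.
- by move=> i iT; apply: (@I_pebble w); apply: run_consecutive; rewrite szN.
- by move=> i i' iT i'T e; rewrite -(ipr _ iT) -(ipr _ i'T) e.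
- move=> j a b i1 i i2 jk ii /and3P[i1T /eqP a1 /eqP b1] /and3P[i2T /eqP a2 /eqP b2].
  have iT : i < N ^ 2 by lia.
  have [e1 e2] : (pr i).1 %/ M j = (pr i1).1 %/ M j /\ (pr i).2 %/ M j = (pr i1).2 %/ M j.
    apply: (pairs_convex Mk M_gt0 M_dvd jk (prp _ i1T) (prp _ iT) (prp _ i2T)).
    - by rewrite -index_pairs ?prp // !ipr //; lia.
    - by rewrite -index_pairs ?prp // !ipr //; lia.
    - by rewrite a1 a2.
    - by rewrite b1 b2.
  by rewrite /window iT e1 e2 a1 b1 !eqxx.
- move=> j a b /andP[j0 jk] aN bN.
  have Mj := M_gt0 jk.
  have sM : s.+1 %| M j by rewrite -Mk M_dvd.
  (* Leaf [t] is the first one of node [a]. With y at the start of node [b], its letters are output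
     consecutively, so some pebble touches the leaf. *)
  pose t := a * (M j %/ s.+1).
  have tE : t * s.+1 = a * M j by rewrite /t -mulnA divnK.
  have aMN : a * M j + M j <= N by rewrite -mulSnr -leq_divRL.
  have sMle : s.+1 <= M j by apply: dvdn_leq.
  have tN : t < N %/ s.+1 by rewrite ltn_divRL ?tE; [lia|rewrite -Mk M_dvd].
  have yN : b * M j < N by rewrite -ltn_divRL // M_dvd //; apply: ltnW.
  have seg d : d <= s -> a * M j + d < N /\
      index (a * M j + d, b * M j) (pairs w) = index (a * M j, b * M j) (pairs w) + d.
    by rewrite -tE; apply: (index_pairs_run Mk M_gt0 M_dvd).
  set i0 := index (a * M j, b * M j) (pairs w) in seg.
  have xyp d : d <= s -> (a * M j + d, b * M j) \in pairs w.
    by move=> ds; rewrite mem_pairs size_tree_word yN andbT (seg _ ds).1.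
  have iT d : d <= s -> i0 + d < N ^ 2.
    by move=> ds; rewrite -(seg _ ds).2 -(size_tree_word k' s M ids) -size_pairs index_mem xyp.
  have pE d : d <= s -> pr (i0 + d) = (a * M j + d, b * M j).
    by move=> ds; rewrite -(seg _ ds).2 /pr nth_index ?xyp.
  (* The output at [i0] is the separator, so the leaf word starts at [i0.+1]. *)
  have fE : take s (drop i0.+1 (f w)) = map inr (ids t).
    have sp : size (pairs w) = N ^ 2 by rewrite size_pairs size_tree_word.
    have iTs := iT _ (leqnn s).
    apply: (@eq_from_nth _ (inr false)) => [|d].
      by rewrite size_takel ?size_map ?size_ids // size_drop size_map sp; lia.
    rewrite size_takel; last by rewrite size_drop size_map sp; lia.
    move=> ds; rewrite nth_take // nth_drop (nth_map (0, 0)); last by rewrite sp; lia.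
    rewrite addSnnS -/(pr _) pE //= /letter_at -tE.
    have lt : t * s.+1 + d.+1 < N by rewrite tE; apply: (seg _ ds).1.
    rewrite nth_mkseq // /tree_letter /dvdn modnMDl divnMDl // modn_small // divn_small //.
    by rewrite addn0 /= (nth_map false) // size_ids.
  have /allPn[e ee /allPn[x xe]] :
      ~~ all (fun e : conf => avoids (t * s.+1).+1 s e.2) (take s (drop i0.+1 (run w))).
    by apply/negP => /(w_touch tN).
  rewrite negbK tE => xo.
  have /(nthP e0)[d] := ee; rewrite size_take => ds.
  have {}ds : d < s by move: ds; case: (ltnP s) => h h2; lia.
  rewrite nth_take // nth_drop addSnnS => eE.
  exists (i0 + d.+1); rewrite /window iT // pE //=.
  have dM : d.+1 < M j by lia.
  rewrite divnMDl // divn_small // addn0 eqxx mulnK // eqxx; split=> //.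
  exists x; rewrite ?eE //; apply/eqP; rewrite divn_eq_interval //; lia.
- move=> j i1 i2 a jk i1T i2T aN; have Mj := M_gt0 (ltnW jk).
  have aMN : a * M j + M j <= size w by rewrite size_tree_word -mulSnr -leq_divRL.
  have [i1s i2s] : i1 < size (run w) /\ i2 < size (run w) by rewrite szN.
  have [theta th] := w_rows jk i1s i2s Mj aMN.
  exists theta => z z' zN z'N /eqP za /eqP z'a tz x /eqP xa.
  rewrite divn_eq_interval // in za; rewrite divn_eq_interval // in z'a.
  rewrite divn_eq_interval // in xa.
  by apply: th; rewrite ?size_tree_word.
Qed.

End Input.

(** Order of choices: [h], [K] and [c] depend on [I] and [k] only; then [s], which fixes the tree;
    then [D] words of one type; finally their distribution over the leaves. *)
Lemma not_pebble_computable : False.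
Proof.
have [T [h hI]] := respects_interp_ex I.
have [K K0 rows] := rows_bound I k.
have [_ _ sz1 _ _] := runP [:: inr false].
have [e0 _] : exists e0 : conf, true.
  by move: sz1; rewrite size_squaring; case: (run _) => // e0; exists e0.
pose c := growth_factor (Defs.comp I) k K.
have c0 : 0 < c.
  suff : 0 < #|Defs.comp I| by rewrite /c /growth_factor; lia.
  by apply/card_gt0P; exists e0.1.
(* Makes [2 ^ s] exceed [#|T| * (3 * N ^ 3)], which bounds [#|T| * D]. *)
have [s s0 big] := exp_beats_poly (#|T| * 3 * c ^ (4 ^ k * 3)) (4 ^ k * 3).
pose M j := iter (k - j) (fun m => c * m ^ 3) s.+1.
have Mk : M k = s.+1 by rewrite /M subnn.
have MS j : j < k -> M j = c * M j.+1 ^ 3.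
  by move=> jk; rewrite /M -(prednK (n := k - j)) ?subn_gt0 // -subnS.
have M_gt0 j : 0 < M j.
  by rewrite /M; elim: (k - j) => //= i IH; rewrite muln_gt0 c0 expn_gt0 IH.
set N := M 0.
have N0 : 0 < N := M_gt0 0.
(* Each of the at most [N] leaves excludes at most [(N ^ 2).+1] words, where [N ^ 2] is the length
   of the run. *)
pose D := (N * (N ^ 2).+1).+1.
have bigD : #|T| * D < #|{: s.-tuple bool}|.
  rewrite card_tuple card_bool; apply: leq_ltn_trans big.
  apply: (@leq_trans (#|T| * (3 * N ^ 3))).
    by rewrite leq_mul2l; apply/orP; right; rewrite /D; nia.
  rewrite -!mulnA !leq_mul2l; apply/orP; right; apply/orP; right.
  by rewrite -expnMn expnM leq_exp2r //; apply: iter_cube_le.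
pose g (v : s.-tuple bool) := h (bare (map inr v : seq (letter k))).
have [pv pv_inj pvh] := @pigeonhole_fiber _ _ g _ bigD.
pose ids (l : {ffun 'I_N -> 'I_D}) t : seq bool :=
  if insub t is Some i then pv (l i) else [::].
have idsE l (t : 'I_N) : ids l t = pv (l t) by rewrite /ids valK.
pose w l := tree_word k' s M (ids l).
pose bad (t : 'I_N) l := `[< t < N %/ s.+1 /\ exists i,
  all (fun e : conf => avoids (t * s.+1).+1 s e.2) (take s (drop i (run (w l)))) /\
  take s (drop i (f (w l))) = map inr (ids l t) >].
have M_dvd' : forall i j, i <= j -> j <= k -> M j %| M i by move=> i j; apply: (@M_dvd K M MS).
have [l good] : exists l, forall t, ~~ bad t l.
  apply: (@exists_good_labelling _ _ (N ^ 2).+1) => // t l.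
  have [tN|Nt] := ltnP t (N %/ s.+1); last first.
    rewrite (_ : [set _ | _] = set0) ?cards0 //; apply/setP => v; rewrite !inE.
    by apply/negbTE/negP => /asboolP[]; rewrite ltnNge Nt.
  pose L := take (t * s.+1).+1 (w l); pose r := drop ((t * s.+1).+1 + s) (w l).
  have wE v : w (update l t v) = L ++ map inr (pv v) ++ r.
    have -> : (pv v : seq bool) = ids (update l t v) t by rewrite idsE ffunE eqxx.
    apply: (tree_word_split Mk M_dvd' tN) => [|x xt].
      by rewrite idsE size_tuple.
    rewrite /ids; case: insubP => // i _ ix; rewrite ffunE; case: eqP => // it.
    by case: xt; rewrite -ix it.
  have oN : (t * s.+1).+1 + s <= N.
    by rewrite addSnnS -mulSnr -leq_divRL.
  have sL : size L = (t * s.+1).+1 by rewrite size_takel // size_tree_word -/N; lia.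
  rewrite cardE -(size_map (fun v => map inr (pv v) : seq (letter k))).
  have inr_inj : injective (inr : bool -> letter k) by move=> ? ? [].
  apply: (@few_untouched _ I T h f L r s _ (fun v => run (L ++ v ++ r))) => //.
  - by rewrite sL.
  - rewrite map_inj_uniq ?enum_uniq // => v v' /(inj_map inr_inj) e.
    by apply: pv_inj; apply: val_inj.
  - by move=> _ /mapP[v _ ->]; rewrite size_map size_tuple.
  - by move=> _ _ /mapP[v _ ->] /mapP[v' _ ->]; apply: pvh.
  - by move=> _ /mapP[v _ ->]; rewrite -wE; have [_ _ -> _ _] := runP (w (update l t v));
      rewrite size_squaring size_tree_word.
  - move=> x /mapP[v]; rewrite mem_enum inE => /asboolP[_ [i [ai fi]]] ->.
    by exists i; rewrite sL -wE fi idsE ffunE eqxx.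
apply: (@input_contradiction s K M e0 (ids l)) => //.
- by move=> j i1 i2 o m; apply: rows => //; rewrite size_tree_word.
- move=> t i tN ai fi.
  have tN' : t < N by apply: leq_trans tN (leq_div _ _).
  by move: (good (Ordinal tN')) => /asboolPn; apply; split=> //; exists i.
- move=> t tN; have tN' : t < N by apply: leq_trans tN (leq_div _ _).
  by rewrite (idsE l (Ordinal tN')) size_tuple.
Qed.

End LowerBound.

Theorem mainTheorem2 :
  forall k : nat, 1 <= k ->
  exists (Sigma Gamma : finType) (f : seq Sigma -> seq Gamma),
    [/\ polyregular f,
        theta_n2 (growth f) &
        ~ exists I : interp Sigma Gamma,
            [/\ pebble_transducer I, dim_le I k & computes I f]].
Proof.
case=> // k _; exists (letter k.+1), (letter k.+1), (@nested_squaring k.+1).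
split; [exact: polyregular_squaring | exact: theta_n2_growth_squaring |].
by case=> I [pI dI /choice[run runP]]; apply: (@not_pebble_computable k I pI dI run).
Qed.
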